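(* Let $n\ge2$ and let $G$ be the free group on $u_1,\dots,u_n$. The only reduced $\sqrt n$-eigenstate of $u_1+\cdots+u_n$ is the function $\phi$ on $G$ given by $$\phi(s)=\begin{cases} n^{-|s|/2} & s\in G^+(G^+)^{-1},\\ 0&\text{otherwise.}\end{cases}$$
   Context: $|s|$ is the length of $s$ as a reduced word in $u_1^{\pm1},\dots,u_n^{\pm1}$. $G^+$ is the unital subsemigroup of $G$ generated by $u_1,\dots,u_n$ (so $1\in G^+$), and $G^+(G^+)^{-1}=\{st^{-1}:s,t\in G^+\}$. A state on $G$ is a positive definite function with value $1$ at the identity, extended linearly to the complex group algebra $\mathbb{C}G$ (with $s^*=s^{-1}$). It is reduced if it extends to a positive linear functional on the reduced C*-algebra $C^*_r(G)$, the operator-norm closure of the image of $\mathbb{C}G$ under the left regular representation on $\ell^2(G)$. For $x\in\mathbb{C}G$ and $\lambda\in\mathbb{C}$, a $\lambda$-eigenstate of $x$ is a state $\psi$ with $\psi((x-\lambda)^*(x-\lambda))=0$. *)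

(* Defs.v *)
From HB Require Import structures.
From mathcomp Require Import all_boot all_order all_algebra.
From mathcomp Require Import all_classical all_reals all_analysis.
From mathcomp Require Import complex ring.

Set Implicit Arguments.
Unset Strict Implicit.
Unset Printing Implicit Defensive.
Import Order.TTheory GRing.Theory Num.Theory.
Local Open Scope classical_set_scope.
Local Open Scope complex_scope.
Local Open Scope ring_scope.

Local Notation normc := ComplexField.Normc.normc.

(* The free group on n generators as the set of reduced words.  The letter
   (i, false) stands for u_i and (i, true) for its inverse. *)

Definition letter (n : nat) := ('I_n * bool)%type.

Definition inv_letter n (a : letter n) : letter n := (a.1, ~~ a.2).

Definition reduced_word n (w : seq (letter n)) : bool :=
  sorted (fun a b => b != inv_letter a) w.

Record free_group (n : nat) := FreeGroup {
  word :> seq (letter n);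
  word_reduced : reduced_word word }.

HB.instance Definition _ n := [isSub for @word n].
HB.instance Definition _ n := [Countable of free_group n by <:].

Section FreeGroup.
Variable n : nat.
Implicit Types (a b : letter n) (s t w : seq (letter n)).

(* Left multiplication of a reduced word by a letter. *)
Definition push a w : seq (letter n) :=
  if w is b :: w' then if b == inv_letter a then w' else a :: w else [:: a].

Lemma inv_letterK : involutive (@inv_letter n).
Proof. by case=> i b; rewrite /inv_letter /= negbK. Qed.

Lemma inv_letter_neq a : a != inv_letter a.
Proof. by case: a => i [] /=; apply/eqP; case. Qed.

Lemma reduced_tail a w : reduced_word (a :: w) -> reduced_word w.
Proof. exact: path_sorted. Qed.

Lemma push_reduced a w : reduced_word w -> reduced_word (push a w).
Proof.
case: w => [|b w] //= rw; case: ifPn => [_|ba]; first exact: reduced_tail rw.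
by rewrite /reduced_word /= ba.
Qed.

Lemma push_cons a w : reduced_word (a :: w) -> push a w = a :: w.
Proof. by case: w => [|b w] //= /andP[/negPf-> _]. Qed.

Lemma pushK a w : reduced_word w -> push (inv_letter a) (push a w) = w.
Proof.
case: w => [|b w] /=; first by rewrite inv_letterK eqxx.
case: ifPn => [/eqP-> rw|_ _]; first exact: push_cons.
by rewrite /= inv_letterK eqxx.
Qed.

Definition word_mul s t := foldr push t s.

Lemma word_mul_reduced s t : reduced_word t -> reduced_word (word_mul s t).
Proof. by move=> rt; elim: s => //= a s; apply: push_reduced. Qed.

Lemma word_mul_push a s t : reduced_word s -> reduced_word t ->
  word_mul (push a s) t = push a (word_mul s t).
Proof.
case: s => [|b s] //= rs rt; case: ifPn => //= /eqP ->.
have := pushK (inv_letter a) (word_mul_reduced s rt).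
by rewrite inv_letterK => ->.
Qed.

Lemma word_mulA r s t : reduced_word s -> reduced_word t ->
  word_mul r (word_mul s t) = word_mul (word_mul r s) t.
Proof.
move=> rs rt; elim: r => //= a r ->.
by rewrite word_mul_push // word_mul_reduced.
Qed.

Lemma word_mul_nil s : reduced_word s -> word_mul s [::] = s.
Proof.
elim: s => //= a s IH rs; rewrite IH ?(reduced_tail rs) //.
exact: push_cons.
Qed.

Definition word_inv s : seq (letter n) := rev (map (@inv_letter n) s).

Lemma word_inv_reduced s : reduced_word s -> reduced_word (word_inv s).
Proof.
rewrite /reduced_word /word_inv rev_sorted sorted_map.
apply: sub_sorted => a b /=; apply: contraNneq => ->.
by rewrite inv_letterK.
Qed.

Lemma word_invK : involutive word_inv.
Proof.
by move=> s; rewrite /word_inv map_rev revK mapK //; apply: inv_letterK.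
Qed.

Lemma word_mulV s : reduced_word s -> word_mul (word_inv s) s = [::].
Proof.
elim: s => //= a s IH rs.
rewrite /word_inv /= rev_cons /word_mul foldr_rcons /= inv_letterK eqxx.
exact: IH (reduced_tail rs).
Qed.

Definition free_one : free_group n := @FreeGroup n [::] isT.
Definition free_mul (s t : free_group n) : free_group n :=
  FreeGroup (word_mul_reduced s (word_reduced t)).
Definition free_inv (s : free_group n) : free_group n :=
  FreeGroup (word_inv_reduced (word_reduced s)).

Lemma free_mulA : associative free_mul.
Proof. by move=> r s t; apply/val_inj/word_mulA; apply: word_reduced. Qed.

Lemma free_mul1 : left_id free_one free_mul.
Proof. by move=> s; apply/val_inj. Qed.

Lemma free_mulr1 : right_id free_one free_mul.
Proof. by move=> s; apply/val_inj/word_mul_nil/word_reduced. Qed.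

Lemma free_mulV : left_inverse free_one free_inv free_mul.
Proof. by move=> s; apply/val_inj/word_mulV/word_reduced. Qed.

Lemma free_mulrV : right_inverse free_one free_inv free_mul.
Proof.
move=> s; have <- : free_inv (free_inv s) = s by apply/val_inj/word_invK.
rewrite [free_inv (free_inv (free_inv s))](_ : _ = free_inv s) ?free_mulV//.
by apply/val_inj/word_invK.
Qed.

HB.instance Definition _ := isGroup.Build (free_group n)
  free_mulA free_mul1 free_mulr1 free_mulV free_mulrV.

Definition free_gen (i : 'I_n) : free_group n := @FreeGroup n [:: (i, false)] isT.

Definition word_length (s : free_group n) : nat := size (word s).

Definition positive_part : set (free_group n) :=
  smallest [set S : set (free_group n) |
              S 1%g /\ (forall g h, S g -> S h -> S (g * h)%g)]
           (range free_gen).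

Definition positive_quotients : set (free_group n) :=
  [set g | exists h k, [/\ positive_part h, positive_part k & g = (h * k^-1)%g]].

End FreeGroup.

Arguments positive_part n : clear implicits.
Arguments positive_quotients n : clear implicits.

Section Ell2.
Variables (R : realType) (G : choiceType).
Local Notation C := R[i].

(* Unordered sums, meaningful for absolutely summable families. *)
Definition sum_real (f : G -> R) : R :=
  fine (\esum_(t in [set: G]) (EFin \o f)^\+ t
        - \esum_(t in [set: G]) (EFin \o f)^\- t)%E.

Definition sum_complex (f : G -> C) : C :=
  sum_real (fun t => complex.Re (f t)) +i* sum_real (fun t => complex.Im (f t)).

Definition sqnorm (f : G -> C) : \bar R :=
  (\esum_(t in [set: G]) ((normc (f t)) ^+ 2)%:E)%E.

(* The values are taken in C^o so that scalars are complex: R[i] itself is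
   canonically an R-module. *)
Definition square_summable : {pred (G -> C^o)} :=
  fun f => `[< (sqnorm f < +oo)%E >].

Lemma sqnorm0 : sqnorm (0 : G -> C^o) = 0%E.
Proof.
by rewrite /sqnorm esum1 // => t _; rewrite /= expr0n /= addr0 sqrtr0 expr0n.
Qed.

Lemma normc_sqr_le (a x y : C) :
  normc (a * x + y) ^+ 2
    <= 2 * normc a ^+ 2 * normc x ^+ 2 + 2 * normc y ^+ 2.
Proof.
have h (z : C) : normc z ^+ 2 = complex.Re z ^+ 2 + complex.Im z ^+ 2.
  by case: z => u v /=; rewrite sqr_sqrtr // addr_ge0 ?sqr_ge0.
rewrite !h; case: a x y => [a1 a2] [x1 x2] [y1 y2] /=.
rewrite -subr_ge0.
set p := a1 * x1 - a2 * x2; set q := a1 * x2 + a2 * x1.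
have -> : 2 * (a1 ^+ 2 + a2 ^+ 2) * (x1 ^+ 2 + x2 ^+ 2) + 2 * (y1 ^+ 2 + y2 ^+ 2)
   - ((p + y1) ^+ 2 + (q + y2) ^+ 2) = (p - y1) ^+ 2 + (q - y2) ^+ 2.
  by rewrite /p /q; ring.
by rewrite addr_ge0 ?sqr_ge0.
Qed.

Lemma esum_scale_le (k : R) (f : G -> R) : 0 <= k -> (forall t, 0 <= f t) ->
  (\esum_(t in [set: G]) (k * f t)%:E
     <= k%:E * \esum_(t in [set: G]) (f t)%:E)%E.
Proof.
move=> k0 f0; apply: ge_ereal_sup => _ [X [finX XG] <-].
rewrite fsbig_finite //= sumEFin -mulr_sumr EFinM lee_wpmul2l ?lee_fin //.
by rewrite -sumEFin -fsbig_finite //; apply: esum_ge; exists X.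
Qed.

Lemma square_summable_lin (a : C) (f g : G -> C^o) :
  f \in square_summable -> g \in square_summable ->
  a *: f + g \in square_summable.
Proof.
move=> /asboolP hf /asboolP hg; apply/asboolP.
have bnd (k : R) (h : G -> C) : 0 <= k -> (sqnorm h < +oo)%E ->
    (\esum_(t in [set: G]) (k * normc (h t) ^+ 2)%:E < +oo)%E.
  move=> k0 hh; apply: le_lt_trans (esum_scale_le k0 _) _.
    by move=> t; rewrite sqr_ge0.
  by apply: lte_mul_pinfty; rewrite ?lee_fin.
have k0 : 0 <= 2 * normc a ^+ 2 :> R by rewrite mulr_ge0 ?sqr_ge0.
apply: (@le_lt_trans _ _ (\esum_(t in [set: G])
   ((2 * normc a ^+ 2 * normc (f t) ^+ 2)%:E + (2 * normc (g t) ^+ 2)%:E))%E).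
  by apply: le_esum => t _; rewrite -EFinD lee_fin normc_sqr_le.
rewrite esumD; first by apply: lte_add_pinfty; apply: bnd.
  by move=> t _; rewrite lee_fin mulr_ge0 ?sqr_ge0.
by move=> t _; rewrite lee_fin mulr_ge0 ?sqr_ge0.
Qed.

Lemma square_summable_closed : subsemimod_closed square_summable.
Proof.
have z : (0 : G -> C^o) \in square_summable.
  by apply/asboolP; rewrite sqnorm0 ltry.
split; first split => //.
  by move=> f g hf hg; rewrite -[f]scale1r square_summable_lin.
by move=> a f hf; rewrite -[a *: f]addr0 square_summable_lin.
Qed.

HB.instance Definition _ :=
  GRing.isSubmodClosed.Build C (G -> C^o) square_summable square_summable_closed.

Record ell2 := Ell2 {
  ell2_fun :> G -> C^o;
  ell2_summable : square_summable ell2_fun }.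

HB.instance Definition _ := [isSub for ell2_fun].
HB.instance Definition _ := [Choice of ell2 by <:].
HB.instance Definition _ := [SubChoice_isSubLmodule of ell2 by <:].

Definition ell2_dot (xi eta : ell2) : C :=
  sum_complex (fun t => xi t * conjc (eta t)).

Definition ell2_norm (xi : ell2) : R := Num.sqrt (fine (sqnorm xi)).

Definition opnorm (T : ell2 -> ell2) : \bar R :=
  ereal_sup [set (ell2_norm (T xi))%:E | xi in [set xi | ell2_norm xi <= 1]].

Definition bounded_operator (T : ell2 -> ell2) : Prop :=
  linear T /\ (opnorm T < +oo)%E.

Definition is_adjoint (T S : ell2 -> ell2) : Prop :=
  forall xi eta, ell2_dot (T xi) eta = ell2_dot xi (S eta).

End Ell2.

Arguments ell2 R G : clear implicits.

Section GroupAlgebra.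
Variables (R : realType) (G : groupType).
Local Notation C := R[i].

Definition finitely_supported : {pred (G -> C^o)} :=
  fun x => `[< finite_set [set s | x s != 0] >].

Lemma finitely_supported_closed : subsemimod_closed finitely_supported.
Proof.
split; first split.
- apply/asboolP; apply: sub_finite_set (finite_set0 G) => s /=.
  by rewrite eqxx.
- move=> x y /asboolP hx /asboolP hy; apply/asboolP.
  apply: sub_finite_set (_ : finite_set ([set s | x s != 0] `|` [set s | y s != 0])).
    move=> s /= xys; apply: contrapT => /not_orP[/negP/negPn/eqP x0 /negP/negPn/eqP y0].
    have xy0 : x s + y s = 0 by rewrite x0 y0 addr0.
    by move/eqP: xys; apply.
  by rewrite finite_setU.
- move=> a x /asboolP hx; apply/asboolP; apply: sub_finite_set hx => s /=.
  apply: contraNneq => x0; apply/eqP.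
  by have ax0 : a *: x s = 0 by rewrite x0 scaler0.
Qed.

HB.instance Definition _ :=
  GRing.isSubmodClosed.Build C (G -> C^o) finitely_supported
    finitely_supported_closed.

Record group_algebra := GroupAlgebra {
  coef :> G -> C^o;
  coef_finite : finitely_supported coef }.

HB.instance Definition _ := [isSub for coef].
HB.instance Definition _ := [Choice of group_algebra by <:].
HB.instance Definition _ := [SubChoice_isSubLmodule of group_algebra by <:].

Lemma delta_finite (s : G) :
  finitely_supported (fun t => (t == s)%:R : C^o).
Proof.
apply/asboolP; apply: sub_finite_set (finite_set1 s) => t /=.
by case: (eqVneq t s) => [->|_ /eqP[]].
Qed.

Definition delta (s : G) : group_algebra := GroupAlgebra (delta_finite s).

Implicit Types x y : group_algebra.

Definition ga_mul x y : group_algebra :=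
  \sum_(s \in [set: G]) \sum_(t \in [set: G]) (x s * y t) *: delta (s * t)%g.

Definition ga_star x : group_algebra :=
  \sum_(s \in [set: G]) conjc (x s) *: delta s^-1%g.

Definition linear_extension (psi : G -> C) x : C :=
  \sum_(s \in [set: G]) x s * psi s.

Definition positive_definite (psi : G -> C) : Prop :=
  forall (k : nat) (g : 'I_k -> G) (c : 'I_k -> C),
    0 <= \sum_(i < k) \sum_(j < k) conjc (c i) * c j * psi ((g i)^-1 * g j)%g.

Definition is_state (psi : G -> C) : Prop :=
  positive_definite psi /\ psi 1%g = 1.

Definition is_eigenstate (lambda : C) x (psi : G -> C) : Prop :=
  is_state psi /\
  linear_extension psi
    (ga_mul (ga_star (x - lambda *: delta 1%g)) (x - lambda *: delta 1%g)) = 0.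

Lemma translate_summable (s : G) (xi : ell2 R G) :
  square_summable (fun t => xi (s^-1 * t)%g).
Proof.
case: xi => f /= /asboolP hf; apply/asboolP; move: hf.
rewrite /sqnorm (@reindex_esum _ _ _ [set: G] [set: G] (fun t => s^-1 * t)%g) //.
split => // [t u _ _ /mulgI //|t _]; exists (s * t)%g => //.
by rewrite mulKg.
Qed.

Definition translate (s : G) (xi : ell2 R G) : ell2 R G :=
  Ell2 (translate_summable s xi).

Definition regular_rep x : ell2 R G -> ell2 R G :=
  \sum_(s \in [set: G]) x s *: translate s.

Definition reduced_algebra : set (ell2 R G -> ell2 R G) :=
  [set T | bounded_operator T /\
    forall e : R, 0 < e -> exists x, (opnorm (T - regular_rep x)%R < e%:E)%E].

(* Only the values of tau on the reduced C*-algebra matter.  In the second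
   clause S is T^*, so S \o T is T^*T. *)
Definition positive_functional (tau : (ell2 R G -> ell2 R G) -> C) : Prop :=
  (forall (a : C) S T, reduced_algebra S -> reduced_algebra T ->
     tau (a *: S + T) = a * tau S + tau T) /\
  (forall S T, reduced_algebra S -> reduced_algebra T -> is_adjoint T S ->
     0 <= tau (S \o T)).

Definition is_reduced_state (psi : G -> C) : Prop :=
  is_state psi /\
  exists2 tau, positive_functional tau &
    forall x, tau (regular_rep x) = linear_extension psi x.

End GroupAlgebra.

Section Phi.
Variables (R : realType) (n : nat).

Definition gen_sum : group_algebra R (free_group n) :=
  \sum_(i < n) delta R (free_gen i).

Definition phi (s : free_group n) : R[i] :=
  if s \in positive_quotients n
  then (n%:R `^ (- ((word_length s)%:R / 2)))%:C
  else 0.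

End Phi.

Arguments phi R n s : clear implicits.

(* Main.v *)
(** Let [x] be the sum of the generators and [z = x - sqrt n]. On ell2, split
    [x / sqrt n] into the part [cancelling] the first letter of a word and the
    part [creating] a new one; since what has been created is never cancelled,
    an approximate [sqrt n]-eigenvector of [x] is almost supported on words that
    do not start with the inverse of a generator ([neg_first_small]). Hence, for
    every [s], [<s eta, eta> - phi(s) |eta|^2] is at most
    [eps |eta|^2 + K |z eta|^2] in absolute value, for all [eps > 0] and a
    suitable [K] ([asymptoticP]).

    A reduced state is nonnegative on positive operators (write [1 - y] as a
    square), so this operator inequality forces a reduced eigenstate to be [phi].
    Conversely, the averages of the vectors [n^(-k/2) sum_(|w| = k) w], [w]
    ranging over positive words, are unit vectors [xi] with [z xi -> 0]; the
    inequality shows that their vector states converge to [phi], on the whole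
    reduced algebra by density. *)

(* The estimate has to be quantitative because exact eigenvectors do not exist: a nonzero vector of
   ell2 killed by z would equal its own [creating] part, hence live on words of length at least k
   for every k. An eigenstate psi satisfies psi(z^*z) = 0 instead, so the term K |z eta|^2 costs it
   nothing, and eps can tend to 0 while K blows up.

   Only z is small on approximate eigenvectors, not its adjoint. So sqrt n times s may be replaced
   by the sum of the s u_l or, taking adjoints, by the sum of the u_l^-1 s, but not by sums with the
   opposite exponents. This recursion shortens a word only at a negative last letter or at a
   positive first one. A word that begins negative and ends positive offers neither, and this is the
   case that [neg_first_small] settles directly. The words whose limit is not 0 are those that the
   recursion strips down to 1, each letter contributing a factor n^(-1/2).

   The hypothesis n >= 2 enters through the factor 1/n in the norm of [creating]: it must be small
   enough for a term to be absorbed. *)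
Require Import Defs.
From mathcomp Require Import all_boot all_order all_algebra finmap.
From mathcomp Require Import all_classical all_reals all_analysis.
From mathcomp Require Import complex ring lra.

Set Implicit Arguments.
Unset Strict Implicit.
Unset Printing Implicit Defensive.
Import Order.TTheory GRing.Theory Num.Theory numFieldNormedType.Exports.
Local Open Scope classical_set_scope.
Local Open Scope complex_scope.
Local Open Scope ring_scope.

Local Notation sum_real := Defs.sum_real.
Local Notation normc := ComplexField.Normc.normc.
Local Notation Re := complex.Re.
Local Notation Im := complex.Im.

(** * Unordered sums and the Hilbert space ell2 *)

Section SumReal.
Variables (R : realType) (G : choiceType).
Implicit Types f g : G -> R.

Definition abs_summable f := summable [set: G] (EFin \o f).

Definition nonneg_sum f : R := fine (\esum_(t in [set: G]) (f t)%:E).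

Lemma abs_summable_le f g :
  (forall t, `|f t| <= g t) -> abs_summable g -> abs_summable f.
Proof.
move=> fg; apply: le_lt_trans; apply: le_esum => t _ /=.
by rewrite !lee_fin; apply: le_trans (fg t) (ler_norm _).
Qed.

Lemma abs_summableD f g :
  abs_summable f -> abs_summable g -> abs_summable (fun t => f t + g t).
Proof. exact: summableD. Qed.

Lemma abs_summableN f : abs_summable f -> abs_summable (fun t => - f t).
Proof. by rewrite /abs_summable summableN. Qed.

Lemma abs_summableZ k f : abs_summable f -> abs_summable (fun t => k * f t).
Proof.
move=> sf; rewrite /abs_summable /summable.
rewrite (eq_esum (b := fun t => (`|k| * `|f t|)%:E)); last first.
  by move=> t _; rewrite /= normrM.
by apply: le_lt_trans (esum_scale_le _ _) _ => //; apply: lte_mul_pinfty.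
Qed.

Lemma abs_summable_ge0 f : (forall t, 0 <= f t) ->
  (\esum_(t in [set: G]) (f t)%:E < +oo)%E -> abs_summable f.
Proof.
by move=> f0; apply: le_lt_trans; apply: le_esum => t _; rewrite /= ger0_norm.
Qed.

Lemma nonneg_sumE f : (forall t, 0 <= f t) -> abs_summable f ->
  (nonneg_sum f)%:E = (\esum_(t in [set: G]) (f t)%:E)%E.
Proof.
move=> f0; rewrite /abs_summable summableE => sf; rewrite fineK //.
by apply: etrans sf; congr (_ \is a _); apply: eq_esum => t _ /=; rewrite ger0_norm.
Qed.

Lemma nonneg_sum_ge0 f : (forall t, 0 <= f t) -> 0 <= nonneg_sum f.
Proof. by move=> f0; apply/fine_ge0/esum_ge0 => t _; rewrite lee_fin. Qed.

Lemma nonneg_sumD f g : (forall t, 0 <= f t) -> (forall t, 0 <= g t) ->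
  abs_summable f -> abs_summable g ->
  nonneg_sum (fun t => f t + g t) = nonneg_sum f + nonneg_sum g.
Proof.
move=> f0 g0 sf sg; apply: EFin_inj; rewrite EFinD !nonneg_sumE //.
- by rewrite -esumD // => t _; rewrite lee_fin.
- by move=> t; rewrite addr_ge0.
- exact: abs_summableD.
Qed.

Lemma nonneg_sumZ k f : 0 <= k -> (forall t, 0 <= f t) -> abs_summable f ->
  nonneg_sum (fun t => k * f t) = k * nonneg_sum f.
Proof.
move=> k0 f0 sf.
have le (c : R) (h : G -> R) : 0 <= c -> (forall t, 0 <= h t) ->
    abs_summable h -> nonneg_sum (fun t => c * h t) <= c * nonneg_sum h.
  move=> c0 h0 sh; rewrite -lee_fin EFinM !nonneg_sumE //.
  - exact: esum_scale_le.
  - by move=> t; rewrite mulr_ge0.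
  - exact: abs_summableZ.
apply/eqP; rewrite eq_le le //=; have [->|kn0] := eqVneq k 0.
  by rewrite mul0r nonneg_sum_ge0 // => t; rewrite mul0r.
(* The reverse inequality is [le] for the factor [k^-1] and the function [k * f]. *)
rewrite -ler_pdivlMl ?lt0r ?kn0 //.
rewrite -[X in nonneg_sum X <= _](_ : (fun t => k^-1 * (k * f t)) = _).
  apply: le; first by rewrite invr_ge0.
    by move=> t; rewrite mulr_ge0.
  exact: abs_summableZ.
by apply/funext => t; rewrite mulKf.
Qed.

(** The value of [sum_real] does not depend on how a summable function is split into a difference of
    nonnegative ones. With [pos_neg_parts], this reduces linearity to the additivity of nonnegative
    sums. *)
Lemma sum_realB f g : (forall t, 0 <= f t) -> (forall t, 0 <= g t) ->
  abs_summable f -> abs_summable g ->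
  sum_real (fun t => f t - g t) = nonneg_sum f - nonneg_sum g.
Proof.
move=> f0 g0 sf sg; rewrite /sum_real.
have := esumB sf sg.
rewrite [X in X^\+%E](_ : _ = EFin \o (fun t => f t - g t)) // => ->; last 2 first.
- by move=> i _; rewrite lee_fin.
- by move=> i _; rewrite lee_fin.
by rewrite -!nonneg_sumE.
Qed.

Lemma sum_real_ge0E f : (forall t, 0 <= f t) -> abs_summable f ->
  sum_real f = nonneg_sum f.
Proof.
move=> f0 sf; have z : abs_summable (fun=> 0).
  by apply: abs_summable_le sf => t; rewrite normr0.
have := sum_realB f0 (fun=> lexx 0) sf z.
rewrite [X in _ - X](_ : _ = 0); last first.
  by rewrite /nonneg_sum esum1.
by rewrite subr0 => <-; congr sum_real; apply/funext => t; rewrite subr0.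
Qed.

Lemma pos_neg_parts f : abs_summable f -> exists a b : G -> R,
  [/\ forall t, 0 <= a t, forall t, 0 <= b t, abs_summable a, abs_summable b &
      f = (fun t => a t - b t)].
Proof.
move=> sf; exists (fun t => `|f t|), (fun t => `|f t| - f t).
have sa : abs_summable (fun t => `|f t|).
  by apply: le_lt_trans sf; apply: le_esum => t _; rewrite /= normr_id.
split => //.
- by move=> t; rewrite subr_ge0 ler_norm.
- by apply: abs_summableD sa _; apply: abs_summableN.
- by apply/funext => t; rewrite opprB addrC subrK.
Qed.

Lemma sum_realD f g : abs_summable f -> abs_summable g ->
  sum_real (fun t => f t + g t) = sum_real f + sum_real g.
Proof.
move=> /pos_neg_parts[a [b [a0 b0 sa sb ->]]].
move=> /pos_neg_parts[c [d [c0 d0 sc sd ->]]].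
rewrite !sum_realB // [X in sum_real X](_ : _ = (fun t => (a t + c t) - (b t + d t))).
  rewrite sum_realB ?nonneg_sumD //; do ?exact: abs_summableD.
  - ring.
  - by move=> t; rewrite addr_ge0.
  - by move=> t; rewrite addr_ge0.
by apply/funext => t; ring.
Qed.

Lemma sum_realN f : abs_summable f -> sum_real (fun t => - f t) = - sum_real f.
Proof.
move=> /pos_neg_parts[a [b [a0 b0 sa sb ->]]].
rewrite [X in sum_real X](_ : _ = (fun t => b t - a t)).
  by rewrite !sum_realB // opprB.
by apply/funext => t; rewrite opprB.
Qed.

Lemma sum_realZ k f : abs_summable f ->
  sum_real (fun t => k * f t) = k * sum_real f.
Proof.
wlog k0 : k / 0 <= k.
  move=> H sf; have [/H->//|k0] := leP 0 k.
  rewrite -[k in RHS]opprK mulNr -H // ?oppr_ge0 ?ltW // -sum_realN //.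
    by congr sum_real; apply/funext => t; rewrite mulNr opprK.
  exact: abs_summableZ.
move=> /pos_neg_parts[a [b [a0 b0 sa sb ->]]].
rewrite [X in sum_real X](_ : _ = (fun t => k * a t - k * b t)).
  rewrite !sum_realB ?nonneg_sumZ -?mulrBr //; try exact: abs_summableZ.
  - by move=> t; rewrite mulr_ge0.
  - by move=> t; rewrite mulr_ge0.
by apply/funext => t; rewrite mulrBr.
Qed.

Lemma sum_real_reindex (e : G -> G) f : bijective e ->
  sum_real (f \o e) = sum_real f.
Proof.
move=> be; rewrite /sum_real.
have sbe : set_bij [set: G] [set: G] e.
  case: be => e' ee' e'e; split => // [x y _ _ /(can_inj ee')//|x _].
  by exists (e' x).
rewrite (reindex_esum _ _ _ (EFin \o f)^\+%E sbe).
rewrite (reindex_esum _ _ _ (EFin \o f)^\-%E sbe).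
by rewrite -[EFin \o (f \o e)]/((EFin \o f) \o e) funepos_comp funeneg_comp.
Qed.

Lemma sum_real0 f : (forall t, f t = 0) -> sum_real f = 0.
Proof.
move=> f0; rewrite (_ : f = fun=> 0); last exact/funext.
have s0 : abs_summable (fun=> 0).
  by rewrite /abs_summable /summable esum1 // => t _ /=; rewrite normr0.
by rewrite sum_real_ge0E // /nonneg_sum esum1.
Qed.

End SumReal.

Section ComplexParts.
Variable R : realType.
Implicit Types x y : R[i].

Lemma ReD x y : Re (x + y) = Re x + Re y. Proof. by case: x; case: y. Qed.
Lemma ImD x y : Im (x + y) = Im x + Im y. Proof. by case: x; case: y. Qed.
Lemma ReN x : Re (- x) = - Re x. Proof. by case: x. Qed.
Lemma ImN x : Im (- x) = - Im x. Proof. by case: x. Qed.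
Lemma ReM x y : Re (x * y) = Re x * Re y - Im x * Im y.
Proof. by case: x; case: y. Qed.
Lemma ImM x y : Im (x * y) = Re x * Im y + Im x * Re y.
Proof. by case: x; case: y. Qed.
Lemma ReJ x : Re (conjc x) = Re x. Proof. by case: x. Qed.
Lemma ImJ x : Im (conjc x) = - Im x. Proof. by case: x. Qed.

Lemma complex_ext x y : Re x = Re y -> Im x = Im y -> x = y.
Proof. by case: x; case: y => a b c d /= -> ->. Qed.

Lemma complex_ge0P x : Im x = 0 -> 0 <= Re x -> 0 <= x.
Proof. by case: x => a b /= -> a0; rewrite lecE /= eqxx. Qed.

Lemma normc_sqr x : normc x ^+ 2 = Re x ^+ 2 + Im x ^+ 2.
Proof. by case: x => u v /=; rewrite sqr_sqrtr // addr_ge0 ?sqr_ge0. Qed.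

Lemma normc_sqrR (k : R) : normc k%:C ^+ 2 = k ^+ 2.
Proof. by rewrite normc_sqr /= expr0n addr0. Qed.

Lemma conjcD x y : conjc (x + y) = conjc x + conjc y. Proof. exact: rmorphD. Qed.
Lemma conjcN x : conjc (- x) = - conjc x. Proof. exact: rmorphN. Qed.
Lemma conjcM x y : conjc (x * y) = conjc x * conjc y. Proof. exact: rmorphM. Qed.

Definition ReImE := (ReD, ImD, ReN, ImN, ReM, ImM, ReJ, ImJ).

End ComplexParts.

(** * Inner product and norm of ell2 *)

Section Hilbert.
Variables (R : realType) (G : choiceType).
Local Notation C := R[i].
Local Notation E := (ell2 R G).
Implicit Types (f g h : E) (a c : C) (k : R).

Lemma ell2P f g : (forall t, f t = g t) -> f = g.
Proof. by move=> fg; apply/val_inj/funext. Qed.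

Lemma ell2_addE f g t : (f + g) t = f t + g t. Proof. by []. Qed.
Lemma ell2_scaleE a f t : (a *: f) t = a * f t. Proof. by []. Qed.
Lemma ell2_oppE f t : (- f) t = - f t. Proof. by []. Qed.
Lemma ell2_sumE (I : Type) (r : seq I) (F : I -> E) t :
  (\sum_(i <- r) F i) t = \sum_(i <- r) F i t.
Proof. by elim/big_ind2: _ => // x y u v <- <-. Qed.

Lemma ell2_finite f : (sqnorm f < +oo)%E.
Proof. by case: f => f /= /asboolP. Qed.

Lemma sqnorm_summable f : abs_summable (fun t => normc (f t) ^+ 2).
Proof. by apply: abs_summable_ge0 (ell2_finite f) => t; rewrite sqr_ge0. Qed.

Definition normsq f : R := fine (sqnorm f).

Lemma normsqE f : (normsq f)%:E = sqnorm f.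
Proof. by apply: nonneg_sumE (sqnorm_summable f) => t; rewrite sqr_ge0. Qed.

Lemma normsq_ge0 f : 0 <= normsq f.
Proof. by apply: nonneg_sum_ge0 => t; rewrite sqr_ge0. Qed.

Lemma dot_summable f g : abs_summable (fun t => Re (f t * conjc (g t)))
                      /\ abs_summable (fun t => Im (f t * conjc (g t))).
Proof.
have s : abs_summable (fun t => normc (f t) ^+ 2 + normc (g t) ^+ 2).
  by apply: abs_summableD; apply: sqnorm_summable.
split; apply: abs_summable_le s => t; rewrite !normc_sqr !ReImE;
  move: (Re (f t)) (Im (f t)) (Re (g t)) (Im (g t)) => p q u v;
  rewrite ler_norml; apply/andP; split.
- have := sqr_ge0 (p + u); have := sqr_ge0 (q + v);
  have := sqr_ge0 p; have := sqr_ge0 q; have := sqr_ge0 u; have := sqr_ge0 v; nra.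
- have := sqr_ge0 (p - u); have := sqr_ge0 (q - v);
  have := sqr_ge0 p; have := sqr_ge0 q; have := sqr_ge0 u; have := sqr_ge0 v; nra.
- have := sqr_ge0 (p - v); have := sqr_ge0 (q + u);
  have := sqr_ge0 p; have := sqr_ge0 q; have := sqr_ge0 u; have := sqr_ge0 v; nra.
- have := sqr_ge0 (p + v); have := sqr_ge0 (q - u);
  have := sqr_ge0 p; have := sqr_ge0 q; have := sqr_ge0 u; have := sqr_ge0 v; nra.
Qed.

Lemma Re_dot f g :
  Re (ell2_dot f g) = sum_real (fun t => Re (f t * conjc (g t))).
Proof. by []. Qed.

Lemma Im_dot f g :
  Im (ell2_dot f g) = sum_real (fun t => Im (f t * conjc (g t))).
Proof. by []. Qed.

Lemma dot_lin a f g h :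
  ell2_dot (a *: f + g) h = a * ell2_dot f h + ell2_dot g h.
Proof.
have [rf imf] := dot_summable f h; have [rg img] := dot_summable g h.
apply: complex_ext; rewrite !ReImE !(Re_dot, Im_dot).
  rewrite [X in sum_real X](_ : _ = fun t => (Re a * Re (f t * conjc (h t))
     + - Im a * Im (f t * conjc (h t))) + Re (g t * conjc (h t))).
    rewrite sum_realD //; last by apply: abs_summableD; apply: abs_summableZ.
    by rewrite sum_realD ?sum_realZ ?mulNr //; apply: abs_summableZ.
  by apply/funext => t; rewrite ell2_addE ell2_scaleE !ReImE; ring.
rewrite [X in sum_real X](_ : _ = fun t => (Re a * Im (f t * conjc (h t))
   + Im a * Re (f t * conjc (h t))) + Im (g t * conjc (h t))).
  rewrite sum_realD //; last by apply: abs_summableD; apply: abs_summableZ.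
  by rewrite sum_realD ?sum_realZ //; apply: abs_summableZ.
by apply/funext => t; rewrite ell2_addE ell2_scaleE !ReImE; ring.
Qed.

Lemma dotC f g : ell2_dot g f = conjc (ell2_dot f g).
Proof.
have [_ im] := dot_summable f g.
apply: complex_ext; rewrite ?ReImE !(Re_dot, Im_dot).
  by congr sum_real; apply/funext => t; rewrite !ReImE; ring.
rewrite -sum_realN //.
by congr sum_real; apply/funext => t; rewrite !ReImE; ring.
Qed.

Lemma dot_normsq f : ell2_dot f f = (normsq f)%:C.
Proof.
apply: complex_ext => /=; last first.
  by apply: sum_real0 => t; rewrite !ReImE; ring.
rewrite [X in sum_real X](_ : _ = fun t => normc (f t) ^+ 2).
  by apply: sum_real_ge0E (sqnorm_summable f) => t; apply: sqr_ge0.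
by apply/funext => t; rewrite normc_sqr !ReImE; ring.
Qed.

Lemma dotDl f g h : ell2_dot (f + g) h = ell2_dot f h + ell2_dot g h.
Proof. by rewrite -[f]scale1r dot_lin mul1r scale1r. Qed.

Lemma dot0l g : ell2_dot 0 g = 0.
Proof. by apply: (addIr (ell2_dot 0 g)); rewrite -dotDl !add0r. Qed.

Lemma dotZl a f g : ell2_dot (a *: f) g = a * ell2_dot f g.
Proof. by rewrite -[a *: f]addr0 dot_lin dot0l addr0. Qed.

Lemma dotDr f g h : ell2_dot f (g + h) = ell2_dot f g + ell2_dot f h.
Proof. by rewrite dotC dotDl conjcD -!dotC. Qed.

Lemma dotZr a f g : ell2_dot f (a *: g) = conjc a * ell2_dot f g.
Proof. by rewrite dotC dotZl conjcM -dotC. Qed.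

Lemma dotNl f g : ell2_dot (- f) g = - ell2_dot f g.
Proof. by rewrite -scaleN1r dotZl mulN1r. Qed.

Lemma dotNr f g : ell2_dot f (- g) = - ell2_dot f g.
Proof. by rewrite dotC dotNl conjcN -dotC. Qed.

Lemma dot_sumr (I : Type) (r : seq I) (F : I -> E) f :
  ell2_dot f (\sum_(i <- r) F i) = \sum_(i <- r) ell2_dot f (F i).
Proof.
elim: r => [|i r IH]; last by rewrite !big_cons dotDr IH.
by rewrite !big_nil dotC dot0l conjc0.
Qed.

Lemma dot_suml (I : Type) (r : seq I) (F : I -> E) f :
  ell2_dot (\sum_(i <- r) F i) f = \sum_(i <- r) ell2_dot (F i) f.
Proof. by elim: r => [|i r IH]; rewrite ?big_nil ?dot0l // !big_cons dotDl IH. Qed.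

Lemma dot_orth f g : (forall t, f t = 0 \/ g t = 0) -> ell2_dot f g = 0.
Proof.
move=> fg; have z t : f t * conjc (g t) = 0.
  by case: (fg t) => ->; rewrite ?mul0r ?conjc0 ?mulr0.
by apply: complex_ext; apply: sum_real0 => t; rewrite z.
Qed.

(** The real part determines the norm and keeps the quadratic inequalities within reach of [lra] and
    [nra]; imaginary parts are recovered by multiplying a vector by a complex scalar. *)
Definition rdot f g : R := Re (ell2_dot f g).

Lemma rdotC f g : rdot f g = rdot g f.
Proof. by rewrite /rdot dotC ReJ. Qed.
Lemma rdotDl f g h : rdot (f + g) h = rdot f h + rdot g h.
Proof. by rewrite /rdot dotDl ReD. Qed.
Lemma rdotDr f g h : rdot f (g + h) = rdot f g + rdot f h.
Proof. by rewrite /rdot dotDr ReD. Qed.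
Lemma rdotNl f g : rdot (- f) g = - rdot f g.
Proof. by rewrite /rdot dotNl ReN. Qed.
Lemma rdotNr f g : rdot f (- g) = - rdot f g.
Proof. by rewrite /rdot dotNr ReN. Qed.
Lemma rdotZl k f g : rdot (k%:C *: f) g = k * rdot f g.
Proof. by rewrite /rdot dotZl ReM /= mul0r subr0. Qed.
Lemma rdotZr k f g : rdot f (k%:C *: g) = k * rdot f g.
Proof. by rewrite rdotC rdotZl rdotC. Qed.
Lemma rdot_normsq f : rdot f f = normsq f.
Proof. by rewrite /rdot dot_normsq. Qed.

Definition rdotE := (rdotDl, rdotDr, rdotNl, rdotNr, rdotZl, rdotZr, rdot_normsq).

Lemma normsqD f g : normsq (f + g) = normsq f + normsq g + 2 * rdot f g.
Proof. by rewrite -rdot_normsq !rdotE (rdotC g f); ring. Qed.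

Lemma normsqB f g : normsq (f - g) = normsq f + normsq g - 2 * rdot f g.
Proof. by rewrite -rdot_normsq !rdotE (rdotC g f); ring. Qed.

Lemma normsqZ c f : normsq (c *: f) = normc c ^+ 2 * normsq f.
Proof.
rewrite -[LHS]rdot_normsq /rdot dotZl dotZr dot_normsq normc_sqr !ReImE /=.
by ring.
Qed.

Lemma normsqZr k f : normsq (k%:C *: f) = k ^+ 2 * normsq f.
Proof. by rewrite normsqZ normc_sqrR. Qed.

Lemma normsqN f : normsq (- f) = normsq f.
Proof. by rewrite -!rdot_normsq rdotNl rdotNr opprK. Qed.

Lemma normsq0 : normsq (0 : E) = 0.
Proof. by rewrite /normsq sqnorm0. Qed.

(** From |k f - g|^2 >= 0. A small weight k trades an arbitrarily small multiple of |f|^2 for a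
    large multiple of |g|^2, which is the shape of every estimate below. *)
Lemma rdot_amgm k f g : 0 < k -> 2 * rdot f g <= k * normsq f + k^-1 * normsq g.
Proof.
move=> k0; have := normsq_ge0 (k%:C *: f - g); rewrite normsqB normsqZr rdotZl => H.
rewrite -(ler_pM2l k0) mulrDr (mulrA k k^-1) divff ?gt_eqF // mul1r; nra.
Qed.

Lemma rdot_amgmN k f g :
  0 < k -> - (2 * rdot f g) <= k * normsq f + k^-1 * normsq g.
Proof. by move=> k0; rewrite -(normsqN g) -mulrN -rdotNr rdot_amgm. Qed.

Lemma normsq_coord f t : normc (f t) ^+ 2 <= normsq f.
Proof.
rewrite -lee_fin normsqE; apply: esum_ge.
by exists [set t]; [split => //; exact: finite_set1|rewrite fsbig_set1].
Qed.

Lemma normsq_eq0 f : normsq f <= 0 -> f = 0.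
Proof.
move=> f0; apply: ell2P => t.
have : normc (f t) ^+ 2 <= 0 by apply: le_trans (normsq_coord f t) f0.
rewrite le_eqVlt ltNge sqr_ge0 orbF sqrf_eq0 => /eqP.
exact: ComplexField.Normc.eq0_normc.
Qed.

Lemma ell2_normE f : ell2_norm f = Num.sqrt (normsq f). Proof. by []. Qed.

Lemma ell2_norm_ge0 f : 0 <= ell2_norm f. Proof. exact: sqrtr_ge0. Qed.

Lemma sqr_ell2_norm f : ell2_norm f ^+ 2 = normsq f.
Proof. by rewrite sqr_sqrtr // normsq_ge0. Qed.

Lemma ell2_norm_le f k : 0 <= k -> (ell2_norm f <= k) = (normsq f <= k ^+ 2).
Proof.
by move=> k0; rewrite -sqr_ell2_norm ler_sqr ?nnegrE // ell2_norm_ge0.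
Qed.

Lemma cauchy_schwarz f g : rdot f g <= ell2_norm f * ell2_norm g.
Proof.
have [f0|f0] := eqVneq (ell2_norm f) 0.
  have /normsq_eq0 -> : normsq f <= 0 by rewrite -sqr_ell2_norm f0 expr0n.
  by rewrite /rdot dot0l mulr_ge0 // ell2_norm_ge0.
have fp : 0 < ell2_norm f by rewrite lt0r f0 ell2_norm_ge0.
have := normsq_ge0 ((ell2_norm g)%:C *: f - (ell2_norm f)%:C *: g).
rewrite normsqB !normsqZr rdotZl rdotZr -!sqr_ell2_norm => H.
have [g0|gn0] := eqVneq (ell2_norm g) 0.
  have /normsq_eq0 -> : normsq g <= 0 by rewrite -sqr_ell2_norm g0 expr0n.
  by rewrite rdotC /rdot dot0l mulr_ge0 // ell2_norm_ge0.
have gp : 0 < ell2_norm g by rewrite lt0r gn0 ell2_norm_ge0.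
rewrite -(ler_pM2l (mulr_gt0 fp gp)); nra.
Qed.

Lemma ell2_normD f g : ell2_norm (f + g) <= ell2_norm f + ell2_norm g.
Proof.
rewrite ell2_norm_le ?addr_ge0 ?ell2_norm_ge0 // normsqD -!sqr_ell2_norm.
have := cauchy_schwarz f g; nra.
Qed.

Lemma ell2_normN f : ell2_norm (- f) = ell2_norm f.
Proof. by rewrite !ell2_normE normsqN. Qed.

Lemma ell2_normZ c f : ell2_norm (c *: f) = normc c * ell2_norm f.
Proof.
rewrite !ell2_normE normsqZ sqrtrM ?sqr_ge0 // sqrtr_sqr ger0_norm //.
by case: c => u v; apply: sqrtr_ge0.
Qed.

Lemma ell2_norm0 : ell2_norm (0 : E) = 0.
Proof. by rewrite ell2_normE normsq0 sqrtr0. Qed.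

Lemma ell2_norm_eq0 f : ell2_norm f <= 0 -> f = 0.
Proof. by rewrite ell2_norm_le // expr0n; apply: normsq_eq0. Qed.

Lemma ell2_norm_sum (I : Type) (r : seq I) (F : I -> E) :
  ell2_norm (\sum_(i <- r) F i) <= \sum_(i <- r) ell2_norm (F i).
Proof.
elim: r => [|i r IH]; first by rewrite !big_nil ell2_norm0.
by rewrite !big_cons; apply: le_trans (ell2_normD _ _) _; rewrite lerD2l.
Qed.

Lemma normsq_sum_le (I : finType) (F : I -> E) :
  normsq (\sum_i F i) <= #|I|%:R * \sum_i normsq (F i).
Proof.
rewrite -sqr_ell2_norm.
apply: (@le_trans _ _ ((\sum_i ell2_norm (F i)) ^+ 2)).
  by rewrite ler_sqr ?nnegrE ?ell2_norm_ge0 ?sumr_ge0 ?ell2_norm_sum // => i _;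
    rewrite ell2_norm_ge0.
set u := fun i => ell2_norm (F i); set c : R := #|I|%:R; set s := \sum_i u i.
have [I0|I0] := posnP #|I|.
  by rewrite /s big_pred0 ?expr0n ?mulr_ge0 ?sumr_ge0 // => i;
    rewrite ?normsq_ge0 //; have := fintype0 i I0.
have c0 : 0 < c by rewrite ltr0n.
(* Squared deviations from the mean [s / c]; expanding gives Cauchy-Schwarz against the constant
   family. *)
have : 0 <= \sum_i (u i - s / c) ^+ 2 by apply: sumr_ge0 => i _; apply: sqr_ge0.
under eq_bigr => i _ do rewrite sqrrB sqr_ell2_norm -mulr_natr -mulrA.
rewrite big_split sumr_const /= sumrB -mulr_suml -/s => H.
suff -> : c * \sum_i normsq (F i) = s ^+ 2 +
    c * (\sum_i normsq (F i) - s * (s / c * 2) + (s / c) ^+ 2 *+ #|I|).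
  by rewrite lerDl; apply: mulr_ge0 (ltW c0) H.
by rewrite -(mulr_natl (_ ^+ 2)) -/c; field; rewrite gt_eqF.
Qed.

End Hilbert.

(** * Completeness of ell2 *)

Section Completeness.
Variables (R : realType) (G : choiceType).
Local Notation E := (ell2 R G).

Lemma cauchy_rate_cvg (u e : nat -> R) : e @ \oo --> (0 : R) ->
  (forall k m, (k <= m)%N -> `|u m - u k| <= e k) -> cvgn u.
Proof.
move=> e0 ue; apply/cauchy_cvgP/cauchy_exP => d d0.
have [N _ hN] : \forall k \near \oo, `|e k| < d.
  by move/cvgr0_norm_lt: e0; apply.
exists (u N); exists N => // k /= Nk; rewrite -ball_normE /= distrC.
apply: le_lt_trans (hN N (leqnn N)).
exact: le_trans (ue _ _ Nk) (ler_norm _).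
Qed.

Lemma cvgn_sum (I : Type) (r : seq I) (F : I -> nat -> R) (l : I -> R) :
  (forall i, F i @ \oo --> l i) ->
  (fun n => \sum_(i <- r) F i n) @ \oo --> \sum_(i <- r) l i.
Proof.
move=> Fl; elim: r => [|i r IH].
  by rewrite big_nil; under eq_cvg do rewrite big_nil; exact: cvg_cst.
by rewrite big_cons; under eq_cvg do rewrite big_cons; exact: cvgD.
Qed.

Lemma square_summable_bounded (f : G -> R[i]^o) (c : R) :
  (forall r : seq G, uniq r -> \sum_(t <- r) normc (f t) ^+ 2 <= c) ->
  (sqnorm f <= c%:E)%E.
Proof.
move=> fc; apply: ge_ereal_sup => _ [X [finX _] <-].
by rewrite fsbig_finite //= sumEFin lee_fin fc // fset_uniq.
Qed.

Lemma normsq_partial (f : E) (r : seq G) : uniq r ->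
  \sum_(t <- r) normc (f t) ^+ 2 <= normsq f.
Proof.
move=> ur; rewrite -lee_fin normsqE -sumEFin; apply: esum_ge.
by exists [set` r]; [split|rewrite fsbig_seq].
Qed.

(** The limit is taken coordinate by coordinate; every finite partial sum of |u m - u k|^2 is at
    most [e k ^+ 2], a bound that survives m -> oo. The rate is kept in the conclusion so that
    pointwise limits of operators can be made uniform on bounded sets. *)
Lemma ell2_complete (u : nat -> E) (e : nat -> R) : e @ \oo --> (0 : R) ->
  (forall k m, (k <= m)%N -> ell2_norm (u m - u k) <= e k) ->
  exists f, forall k, ell2_norm (f - u k) <= e k.
Proof.
move=> e0 ue.
have e_ge0 k : 0 <= e k by apply: le_trans (ell2_norm_ge0 _) (ue _ _ (leqnn k)).
have coord k m t : (k <= m)%N ->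
    Re (u m t - u k t) ^+ 2 + Im (u m t - u k t) ^+ 2 <= e k ^+ 2.
  move=> /ue; rewrite ell2_norm_le // -normc_sqr; apply: le_trans.
  exact: (normsq_coord (u m - u k)).
have cRe t : cvgn (fun k => Re (u k t)).
  apply: cauchy_rate_cvg e0 _ => k m km; rewrite -ReN -ReD.
  rewrite -[e k]ger0_norm // -ler_sqr ?nnegrE // !real_normK ?num_real //.
  by apply: le_trans (coord _ _ t km); rewrite lerDl sqr_ge0.
have cIm t : cvgn (fun k => Im (u k t)).
  apply: cauchy_rate_cvg e0 _ => k m km; rewrite -ImN -ImD.
  rewrite -[e k]ger0_norm // -ler_sqr ?nnegrE // !real_normK ?num_real //.
  by apply: le_trans (coord _ _ t km); rewrite lerDr sqr_ge0.
pose f t : R[i]^o := lim ((fun k => Re (u k t)) @ \oo) +i* lim ((fun k => Im (u k t)) @ \oo).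
have fu k : (sqnorm (fun t => f t - u k t)%R <= (e k ^+ 2)%:E)%E.
  apply: square_summable_bounded => r ur.
  rewrite (eq_bigr (fun t => (Re (f t) - Re (u k t)) * (Re (f t) - Re (u k t))
      + (Im (f t) - Im (u k t)) * (Im (f t) - Im (u k t)))); last first.
    by move=> t _; rewrite normc_sqr !ReImE !expr2.
  have cv : \sum_(t <- r) ((Re (u m t) - Re (u k t)) * (Re (u m t) - Re (u k t))
      + (Im (u m t) - Im (u k t)) * (Im (u m t) - Im (u k t))) @[m --> \oo] -->
      \sum_(t <- r) ((Re (f t) - Re (u k t)) * (Re (f t) - Re (u k t))
      + (Im (f t) - Im (u k t)) * (Im (f t) - Im (u k t))).
    apply: cvgn_sum => t.
    by apply: cvgD; apply: cvgM; (apply: cvgB; [|exact: cvg_cst]);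
      [exact: cRe|exact: cRe|exact: cIm|exact: cIm].
  apply: (ler_cvg_to cv (cvg_cst _)); exists k => // m /= km.
  apply: le_trans (_ : normsq (u m - u k) <= _); last by rewrite -ell2_norm_le // ue.
  apply: le_trans (normsq_partial _ ur); apply: ler_sum => t _.
  by rewrite normc_sqr !ReImE !expr2.
have sf k : square_summable (fun t => f t - u k t).
  by apply/asboolP; apply: le_lt_trans (fu k) (ltry _).
(* [f] is known to be square summable only through [f - u 0], so the limit is rebuilt from that
   difference. *)
exists (Ell2 (sf 0%N) + u 0%N) => k.
rewrite (_ : _ - u k = Ell2 (sf k)).
  by rewrite ell2_norm_le // -lee_fin normsqE; exact: fu.
apply: ell2P => t; rewrite !ell2_addE ell2_oppE.
exact: (congr1 (fun x => x - u k t) (subrK (u 0%N t) (f t))).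
Qed.

End Completeness.

(** * Restriction of vectors to a set of indices *)

Section Cutoff.
Variables (R : realType) (G : choiceType).
Local Notation E := (ell2 R G).
Implicit Types (A : pred G) (f g : E).

Lemma cutoff_summable A f : square_summable (fun t => if A t then f t else 0).
Proof.
apply/asboolP; apply: le_lt_trans (ell2_finite f); apply: le_esum => t _ /=.
rewrite lee_fin; case: (A t) => //.
by rewrite /= !expr0n addr0 sqrtr0 expr0n sqr_ge0.
Qed.

Definition cutoff A f : E := Ell2 (cutoff_summable A f).

Lemma cutoffE A f t : cutoff A f t = if A t then f t else 0. Proof. by []. Qed.

Lemma cutoffD A f g : cutoff A (f + g) = cutoff A f + cutoff A g.
Proof.
apply: ell2P => t; rewrite ell2_addE !cutoffE ell2_addE.
by case: ifP; rewrite ?addr0.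
Qed.

Lemma cutoffN A f : cutoff A (- f) = - cutoff A f.
Proof.
apply: ell2P => t; rewrite ell2_oppE !cutoffE ell2_oppE.
by case: ifP; rewrite ?oppr0.
Qed.

Lemma rdot_orth f g : (forall t, f t = 0 \/ g t = 0) -> rdot f g = 0.
Proof. by move=> fg; rewrite /rdot dot_orth. Qed.

Lemma normsqD_orth f g : (forall t, f t = 0 \/ g t = 0) ->
  normsq (f + g) = normsq f + normsq g.
Proof. by move=> fg; rewrite normsqD rdot_orth // mulr0 addr0. Qed.

Lemma cutoff_split A f : f = cutoff A f + cutoff (predC A) f.
Proof.
apply: ell2P => t; rewrite ell2_addE !cutoffE /=.
by case: (A t); rewrite ?addr0 ?add0r.
Qed.

Lemma normsq_split A f :
  normsq f = normsq (cutoff A f) + normsq (cutoff (predC A) f).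
Proof.
rewrite [in LHS](cutoff_split A f) normsqD_orth // => t; rewrite !cutoffE /=.
by case: (A t); [right|left].
Qed.

Lemma normsq_cutoff_le A f : normsq (cutoff A f) <= normsq f.
Proof. by rewrite (normsq_split A f) lerDl normsq_ge0. Qed.

End Cutoff.

(** * Left translations as unitary operators *)

Section Translate.
Variables (R : realType) (G : groupType).
Local Notation E := (ell2 R G).
Implicit Types (s t : G) (f g : E).

Lemma translateE s f t : translate s f t = f (s^-1 * t)%g. Proof. by []. Qed.

Lemma translateD s f g : translate s (f + g) = translate s f + translate s g.
Proof. exact: ell2P. Qed.

Lemma translateN s f : translate s (- f) = - translate s f.
Proof. exact: ell2P. Qed.

Lemma translateZ s a f : translate s (a *: f) = a *: translate s f.
Proof. exact: ell2P. Qed.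

Lemma translate_sum s (I : Type) (r : seq I) (F : I -> E) :
  translate s (\sum_(i <- r) F i) = \sum_(i <- r) translate s (F i).
Proof.
elim: r => [|i r IH]; last by rewrite !big_cons translateD IH.
by rewrite !big_nil; apply: ell2P.
Qed.

Lemma translate1 f : translate 1%g f = f.
Proof. by apply: ell2P => t; rewrite translateE invg1 mul1g. Qed.

Lemma translateM s t f : translate (s * t)%g f = translate s (translate t f).
Proof. by apply: ell2P => x; rewrite !translateE invgM mulgA. Qed.

Lemma dot_translate s f g :
  ell2_dot (translate s f) g = ell2_dot f (translate s^-1%g g).
Proof.
have bs : bijective (fun t : G => s * t)%g.
  by exists (fun t => s^-1 * t)%g => t; rewrite ?mulKg ?mulVKg.
apply: complex_ext; rewrite !(Re_dot, Im_dot) -[LHS](sum_real_reindex _ bs);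
  by congr Defs.sum_real; apply/funext => t /=; rewrite /= mulKg invgK.
Qed.

Lemma normsq_translate s f : normsq (translate s f) = normsq f.
Proof.
apply: complexI; rewrite -!dot_normsq dot_translate -translateM mulVg.
by rewrite translate1.
Qed.

Lemma ell2_norm_translate s f : ell2_norm (translate s f) = ell2_norm f.
Proof. by rewrite !ell2_normE normsq_translate. Qed.

End Translate.

(** * Reduced words *)

Section Words.
Variable n : nat.
Implicit Types (a b : letter n) (v w : seq (letter n)) (s t : free_group n).

Definition negative a : bool := a.2.

Lemma free_group_ext s t : word s = word t -> s = t.
Proof. exact: val_inj. Qed.

Lemma word_mulE s t : word (s * t)%g = word_mul s t.
Proof. by []. Qed.

Lemma word_invE s : word (s^-1)%g = word_inv s.
Proof. by []. Qed.

Lemma word_mul_cat v w : reduced_word (v ++ w) -> word_mul v w = v ++ w.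
Proof.
elim: v => //= a v IH rvw; rewrite IH ?push_cons //.
exact: reduced_tail rvw.
Qed.

Lemma reduced_cat v a b w :
  reduced_word (rcons v a ++ b :: w) =
    [&& reduced_word (rcons v a), b != inv_letter a & reduced_word (b :: w)].
Proof.
rewrite /reduced_word; case: v => [|c v] /=; first by [].
by rewrite cat_path /= last_rcons.
Qed.

Lemma reduced_rcons v a : reduced_word (rcons v a) -> reduced_word v.
Proof. by rewrite /reduced_word; case: v => //= b v; rewrite rcons_path => /andP[]. Qed.

Lemma rcons_inv_cancel s v a : word s = rcons v (inv_letter a) ->
  forall t, word t = [:: a] -> word (s * t)%g = v.
Proof.
move=> sv t ta; rewrite word_mulE sv ta /word_mul foldr_rcons /= inv_letterK eqxx.
by apply: word_mul_nil; have := word_reduced s; rewrite sv => /reduced_rcons.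
Qed.

Lemma mul_gen_last s v i l : word s = rcons v (i, true) -> l != i ->
  word (s * free_gen l)%g = rcons (word s) (l, false).
Proof.
move=> sv li; rewrite word_mulE word_mul_cat; first by rewrite cats1.
rewrite sv reduced_cat -sv word_reduced /= andbT /inv_letter /=.
by apply: contraNneq li => -[->].
Qed.

Lemma mul_neg_start s v a t : word s = rcons v a -> ~~ negative a ->
  ~~ nilp (word t) -> ~~ negative (head a (word t)) ->
  word (s * t)%g = word s ++ word t.
Proof.
move=> sv apos; rewrite word_mulE => tn bpos; rewrite word_mul_cat //.
move: tn bpos (word_reduced t); case: (word t) => // b u _ bpos rt.
rewrite sv reduced_cat -sv word_reduced rt andbT /=.
by apply: contraNneq bpos => ->; rewrite /negative /=.
Qed.

(* Reduced words of elements of G^+ (G^+)^-1, see [positive_quotientsE]. *)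
Fixpoint positive_negative w : bool :=
  if w is a :: w' then
    if negative a then all negative w' else positive_negative w'
  else true.

Lemma positive_negative_rcons w a : positive_negative (rcons w a) =
  if negative a then positive_negative w else ~~ has negative w.
Proof.
elim: w => [|b w IH] /=; first by case: (negative a).
rewrite IH all_rcons; case: (negative a) (negative b) => [] [] //=.
Qed.

Lemma positive_negative_pos w : ~~ has negative w -> positive_negative w.
Proof. by elim: w => //= a w IH; case: (negative a). Qed.

Lemma has_negative_inv w : has negative (word_inv w) = ~~ all negative w.
Proof.
rewrite /word_inv has_rev has_map -has_predC; apply: eq_has => a.
by rewrite /= /negative.
Qed.

Lemma all_negative_positive_negative w : all negative w -> positive_negative w.
Proof. by case: w => //= a w /andP[-> ->]. Qed.

Lemma positive_negative_push w i : positive_negative w ->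
  positive_negative (push (i, false) w).
Proof.
case: w => //= b w; case: (b =P _) => [->|_] //=.
exact: all_negative_positive_negative.
Qed.

(** Positive letters never cancel one another, so the words without negative letters form a unital
    semigroup containing the generators; conversely such a word is the product of its letters. *)
Lemma positive_partE s : positive_part n s <-> ~~ has negative (word s).
Proof.
split.
  move/(_ [set t : free_group n | ~~ has negative (word t)]); apply.
  split => [|_ [i _ <-]] //; split => // g h /= gpos hpos.
  elim: (word g) gpos => //= a w IH; rewrite negb_or.
  case/andP => apos /IH; case: (word_mul w h) => /= [|b u].
    by rewrite orbF => _.
  by rewrite !negb_or => /andP[bpos upos]; case: ifP => //= _; rewrite !negb_or apos bpos.
case: s => w; elim: w => [|[i []] w IH] rw //= wpos S [[S1 SM] gS].
  by rewrite (_ : FreeGroup rw = 1%g) //; apply: free_group_ext.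
have rw' := reduced_tail rw.
rewrite (_ : FreeGroup rw = (free_gen i * FreeGroup rw')%g); last first.
  by apply: free_group_ext; rewrite word_mulE /= push_cons.
have gSi : S (free_gen i) by apply: gS; exists i.
exact: SM _ _ gSi (IH rw' wpos S (conj (conj S1 SM) gS)).
Qed.

(** In h k^-1 the letters of h are pushed one at a time onto the negative word k^-1: each is either
    cancelled or added in front, and both keep the shape. Conversely h is read off up to the first
    negative letter, and the rest is k^-1. *)
Lemma positive_quotientsE s : positive_quotients n s <-> positive_negative (word s).
Proof.
split=> [[h [k [/positive_partE hpos /positive_partE kpos ->]]]|].
  have : positive_negative (word (k^-1)%g).
    apply: all_negative_positive_negative; rewrite word_invE.
    by rewrite -[all _ _]negbK -has_negative_inv word_invK.
  rewrite word_mulE; elim: (word h) hpos => //= [[i b] w] IH; rewrite negb_or.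
  by case/andP=> /negbTE /= ib /IH H /H; rewrite /negative /= in ib *; rewrite ib;
    apply: positive_negative_push.
case: s => w; elim: w => [|[i b] w IH] rw /= pw.
  exists 1%g, 1%g; split; do ?exact/positive_partE.
  by rewrite invg1 mulg1; apply: free_group_ext.
move: pw; case: b rw => rw /= pw.
  exists 1%g, (FreeGroup rw)^-1%g; split; first exact/positive_partE.
    apply/positive_partE; rewrite word_invE has_negative_inv negbK /=.
    exact: pw.
  by rewrite invgK mul1g.
have rw' := reduced_tail rw.
have [h [k [hpos kpos hk]]] := IH rw' pw.
exists (free_gen i * h)%g, k; split => //.
  by apply/positive_partE; move/positive_partE: hpos; rewrite word_mulE /=;
   case: (word h) => //= b u; case: ifP => //= _; rewrite negb_or => /andP[].
rewrite -mulgA -hk; apply: free_group_ext.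
by rewrite word_mulE /= push_cons.
Qed.

End Words.

Lemma normsq_sum_orth (R : realType) (G : choiceType) (I : finType)
    (F : I -> ell2 R G) :
  (forall i j t, i != j -> F i t = 0 \/ F j t = 0) ->
  normsq (\sum_i F i) = \sum_i normsq (F i).
Proof.
move=> orth; apply: complexI; rewrite -dot_normsq dot_suml rmorph_sum.
apply: eq_bigr => i _; rewrite dot_sumr (bigD1 i) //= dot_normsq big1 ?addr0 // => j ji.
by apply: dot_orth => t; apply: orth; rewrite eq_sym.
Qed.

(** * Approximate eigenvectors *)

Section KeyEstimate.
Variables (R : realType) (n : nat).
Hypothesis hn : (2 <= n)%N.
Local Notation G := (free_group n).
Local Notation E := (ell2 R G).
Implicit Types (f g eta : E) (s t : G).

Definition root_n : R := Num.sqrt n%:R.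

Lemma n_gt0 : 0 < n%:R :> R.
Proof. by rewrite ltr0n (leq_trans _ hn). Qed.

Lemma root_n_gt0 : 0 < root_n.
Proof. by rewrite sqrtr_gt0 n_gt0. Qed.

Lemma root_n_sqr : root_n ^+ 2 = n%:R.
Proof. by rewrite sqr_sqrtr // ltW // n_gt0. Qed.

Definition first_letter (a : letter n) : pred G := fun t => ohead (word t) == Some a.

Definition neg_first : pred G :=
  fun t => if word t is a :: _ then negative a else false.

(** By contraposition, the i-th summand of [creating] lives on words starting with u_i, so the
    summands have disjoint supports. *)
Lemma gen_inv_neg_first i t : ~~ first_letter (i, false) t ->
  first_letter (i, true) ((free_gen i)^-1 * t)%g.
Proof.
rewrite /first_letter word_mulE /=; case: (word t) => [|b w] /=; first by rewrite eqxx.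
by case: (b =P _) => [->|_ _]; rewrite /= eqxx.
Qed.

(* [x / sqrt n = cancelling + creating]: whether [u_i] is applied to a word
   starting with [u_i^-1] or not. *)
Definition cancelling f : E :=
  root_n^-1%:C *: \sum_i translate (free_gen i) (cutoff (first_letter (i, true)) f).

Definition creating f : E :=
  root_n^-1%:C *:
    \sum_i translate (free_gen i) (cutoff (predC (first_letter (i, true))) f).

Definition eigen_defect f : E := \sum_i translate (free_gen i) f - root_n%:C *: f.

Lemma cancelling_creating f :
  cancelling f + creating f = f + root_n^-1%:C *: eigen_defect f.
Proof.
rewrite /eigen_defect scalerBr scalerA -rmorphM mulVf ?gt_eqF ?root_n_gt0 // scale1r.
rewrite [RHS]addrC subrK -scalerDr -big_split /=; congr (_ *: _); apply: eq_bigr => i _.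
by rewrite -translateD -cutoff_split.
Qed.

Lemma cancellingD f g : cancelling (f + g) = cancelling f + cancelling g.
Proof.
rewrite -scalerDr -big_split /=; congr (_ *: _); apply: eq_bigr => i _.
by rewrite cutoffD translateD.
Qed.

Lemma cancelling_neg f : cancelling (cutoff neg_first f) = cancelling f.
Proof.
congr (_ *: _); apply: eq_bigr => i _; congr translate.
apply: ell2P => t; rewrite !cutoffE; case: ifP => //.
by rewrite /first_letter /neg_first; case: (word t) => //= a w /eqP[->].
Qed.

Lemma creating_neg f t : neg_first t -> creating f t = 0.
Proof.
move=> tneg; rewrite ell2_scaleE ell2_sumE big1 ?mulr0 // => i _.
rewrite translateE cutoffE /= gen_inv_neg_first //.
move: tneg; rewrite /neg_first /first_letter; case: (word t) => //= a w.
by apply: contraTneq => -[->].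
Qed.

Lemma cancelling_creating0 f : cancelling (creating f) = 0.
Proof.
rewrite -cancelling_neg (_ : cutoff _ _ = 0).
  rewrite /cancelling big1 ?scaler0 // => i _.
  by apply: ell2P => t; rewrite translateE cutoffE; case: ifP.
by apply: ell2P => t; rewrite cutoffE; case: ifP => // /creating_neg ->.
Qed.

Lemma normsq_neg f :
  normsq (cutoff neg_first f) = \sum_i normsq (cutoff (first_letter (i, true)) f).
Proof.
rewrite -normsq_sum_orth; last first.
  move=> i j t ij; rewrite !cutoffE /first_letter; case: ifP => [/eqP->|_]; last by left.
  by right; case: ifP => // /eqP[ji]; rewrite ji eqxx in ij.
congr normsq; apply: ell2P => t; rewrite ell2_sumE cutoffE /neg_first.
case Et: (word t) => [|[j b] w].
  by rewrite big1 // => i _; rewrite cutoffE /first_letter Et.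
rewrite (bigD1 j) // cutoffE /first_letter Et big1.
  suff -> : (ohead ((j, b) :: w) == Some (j, true)) = b by rewrite [RHS]addr0.
  by apply/eqP/idP => [[->]|->].
move=> i ij; rewrite cutoffE /first_letter Et.
by case: eqP => // -[ji]; rewrite ji eqxx in ij.
Qed.

Lemma sqr_root_n_inv : root_n^-1 ^+ 2 = n%:R^-1.
Proof. by rewrite exprVn root_n_sqr. Qed.

(** The n translates may overlap, so Cauchy-Schwarz is used; its factor n is compensated exactly by
    the square of [root_n^-1]. *)
Lemma normsq_cancelling_le f : normsq (cancelling f) <= normsq (cutoff neg_first f).
Proof.
rewrite normsqZr sqr_root_n_inv ler_pdivrMl ?n_gt0 // normsq_neg.
apply: le_trans (normsq_sum_le _) _; rewrite card_ord.
by under eq_bigr => i _ do rewrite normsq_translate.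
Qed.

(** The summands are orthogonal, and the i-th one loses only the part of [f] on words starting with
    u_i^-1. These losses add up to the whole part on negative first letters, before the division by
    n. *)
Lemma normsq_creating f :
  normsq (creating f) = normsq f - n%:R^-1 * normsq (cutoff neg_first f).
Proof.
rewrite normsqZr sqr_root_n_inv normsq_sum_orth; last first.
  move=> i j t ij; rewrite !translateE !cutoffE /=.
  case: ifPn => [|ti]; [move=> ti|by left].
  case: ifPn => [tj|]; [|by right].
  have {}ti : first_letter (i, false) t by apply: contraNT ti => /gen_inv_neg_first.
  have {}tj : first_letter (j, false) t by apply: contraNT tj => /gen_inv_neg_first.
  by move: ti; rewrite /first_letter (eqP tj) => /eqP[ji]; rewrite ji eqxx in ij.
under eq_bigr => i _ do rewrite normsq_translate.
have n0 : n%:R != 0 :> R by rewrite gt_eqF ?n_gt0.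
rewrite -[X in _ = X - _](mulKf n0) -mulrBr; congr (_ * _).
rewrite normsq_neg (_ : n%:R * _ = \sum_(i < n) normsq f); last first.
  by rewrite sumr_const card_ord mulr_natl.
rewrite -sumrB; apply: eq_bigr => i _.
by rewrite [in RHS](normsq_split (first_letter (i, true)) f) addrC addKr.
Qed.

(* For an exact eigenvector, [eta = zeta + theta] with [zeta = cancelling eta] and
   [theta = creating eta]; [cancelling] is a contraction fixing [zeta], so [zeta]
   lives on words with a negative first letter, orthogonally to [theta], and
   [|theta|^2 = |eta|^2 - |zeta|^2 / n] gives [zeta = 0]. The proof makes this
   quantitative, with [d] the error. *)
Lemma neg_first_small (eps : R) : 0 < eps -> exists K, forall eta,
  normsq (cutoff neg_first eta) <= eps * normsq eta + K * normsq (eigen_defect eta).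
Proof.
(* The inequalities below add up to |P eta|^2 <= 3/4 |P eta|^2 + 9/2 k |eta|^2 + (9/2 + 3/2 k^-1 +
   3/2 k^-3) |d|^2. Absorbing the first term multiplies the others by 4, whence 18 here and 18, 6, 6
   in the witness. *)
move=> eps0; pose k := eps / 18; have k0 : 0 < k by rewrite divr_gt0.
exists ((18 + 6 * k^-1 + 6 * (k^-1 * (k ^+ 2)^-1)) * root_n^-1 ^+ 2) => eta.
rewrite -mulrA -normsqZr; set d := _ *: eigen_defect eta.
pose P (f : E) := cutoff neg_first f; pose zeta := cancelling eta; pose theta := creating eta.
have eq1 : zeta + theta = eta + d := cancelling_creating eta.
have eq2 : cancelling zeta = zeta + cancelling d.
  by rewrite /zeta -cancellingD -cancelling_creating cancellingD cancelling_creating0 addr0.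
pose rho := cutoff (predC neg_first) zeta.
have zeta_le : normsq zeta <= normsq eta.
  exact: le_trans (normsq_cancelling_le _) (normsq_cutoff_le _ _).
have Cd_le : normsq (cancelling d) <= normsq d.
  exact: le_trans (normsq_cancelling_le _) (normsq_cutoff_le _ _).
(* [cancelling] is a contraction that sees only negative first letters, so |rho|^2 <= |zeta|^2 -
   |cancelling zeta|^2, which is of the order of the error. The weight is [k ^+ 2] because |rho|^2
   is multiplied by [k^-1] at the end. *)
have rho_le : normsq rho <= k ^+ 2 * normsq eta + (k ^+ 2)^-1 * normsq d.
  have := normsq_cancelling_le zeta; rewrite eq2 normsqD.
  have := normsq_split neg_first zeta; rewrite -/rho => e1 e2.
  have k2 : 0 < k ^+ 2 by rewrite exprn_gt0.
  have := rdot_amgmN zeta (cancelling d) k2.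
  have : k ^+ 2 * normsq zeta <= k ^+ 2 * normsq eta by rewrite ler_pM2l.
  have : (k ^+ 2)^-1 * normsq (cancelling d) <= (k ^+ 2)^-1 * normsq d.
    by rewrite ler_pM2l ?invr_gt0.
  have := normsq_ge0 (cancelling d); lra.
have eq3 : normsq eta + normsq d + 2 * rdot eta d
         = normsq zeta + normsq theta + 2 * rdot rho theta.
  rewrite -normsqD -eq1 normsqD; congr (_ + 2 * _).
  rewrite [in LHS](cutoff_split neg_first zeta) rdotDl rdot_orth ?add0r // => t.
  by rewrite cutoffE; case: ifP => [/creating_neg ->|_]; [right|left].
have eq4 : normsq theta = normsq eta - n%:R^-1 * normsq (P eta) := normsq_creating eta.
have theta_le : normsq theta <= normsq eta.
  by rewrite eq4 gerBl mulr_ge0 ?normsq_ge0 // invr_ge0 ltW // n_gt0.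
have P_le : normsq (P eta) <= 3 / 2 * normsq zeta + 3 * normsq d.
  have -> : P eta = P zeta - P d.
    transitivity (P (zeta - d + theta)); first by rewrite addrAC eq1 addrK.
    rewrite /P 2!cutoffD cutoffN -[RHS]addr0; congr (_ + _).
    by apply: ell2P => t; rewrite cutoffE; case: ifP => // /creating_neg ->.
  rewrite normsqB.
  (* Any weight below 1 would do: it keeps the factor of |zeta|^2 below 2, hence below n. *)
  have h2 : 0 < 1 / 2 :> R by lra.
  have := rdot_amgmN (P zeta) (P d) h2.
  have := normsq_cutoff_le neg_first zeta; have := normsq_cutoff_le neg_first d.
  rewrite -/(P zeta) -/(P d) div1r invrK.
  lra.
(* Here n >= 2 is used: 3/2 times 1/2 is less than 1, so |P eta|^2 can be absorbed. *)
have nP : n%:R^-1 * normsq (P eta) <= 1 / 2 * normsq (P eta).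
  rewrite ler_wpM2r ?normsq_ge0 // div1r lef_pV2 ?posrE ?n_gt0 //.
  by rewrite ler_nat.
have := rdot_amgm eta d k0; have := rdot_amgmN theta rho k0; rewrite (rdotC theta).
have : k * normsq theta <= k * normsq eta by rewrite ler_pM2l.
have : k^-1 * normsq rho <= k * normsq eta + k^-1 * (k ^+ 2)^-1 * normsq d.
  rewrite (_ : _ + _ = k^-1 * (k ^+ 2 * normsq eta + (k ^+ 2)^-1 * normsq d)).
    by rewrite ler_pM2l ?invr_gt0.
  by field; rewrite gt_eqF.
rewrite -/P (_ : eps = 18 * k); last by rewrite /k mulrC divfK.
lra.
Qed.

End KeyEstimate.

(** * Quadratic forms that vanish along approximate eigenvectors *)

Section Negligible.
Variables (R : realType) (n : nat).
Hypothesis hn : (2 <= n)%N.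
Local Notation G := (free_group n).
Local Notation E := (ell2 R G).
Local Notation C := R[i].
Implicit Types (f g eta : E) (s t : G) (Q : E -> C).

(** Since c ranges over all scalars, opposite and imaginary ones included, a one-sided bound on a
    real part controls |Q|, and closure under scalar multiples is immediate. *)
Definition negligible Q : Prop := forall (c : C) (eps : R), 0 < eps ->
  exists K, forall eta, Re (c * Q eta) <= eps * normsq eta + K * normsq (eigen_defect eta).

Lemma negligibleD Q1 Q2 : negligible Q1 -> negligible Q2 ->
  negligible (fun eta => Q1 eta + Q2 eta).
Proof.
move=> n1 n2 c eps eps0; have e2 : 0 < eps / 2 by rewrite divr_gt0.
have [K1 h1] := n1 c _ e2; have [K2 h2] := n2 c _ e2; exists (K1 + K2) => eta.
have := h1 eta; have := h2 eta; rewrite mulrDr ReD; lra.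
Qed.

Lemma negligibleZ a Q : negligible Q -> negligible (fun eta => a * Q eta).
Proof.
move=> nQ c eps eps0; have [K h] := nQ (c * a) _ eps0; exists K => eta.
by rewrite mulrA.
Qed.

Lemma negligibleB Q1 Q2 : negligible Q1 -> negligible Q2 ->
  negligible (fun eta => Q1 eta - Q2 eta).
Proof.
move=> n1 /(negligibleZ (-1)) n2; rewrite [X in negligible X](_ : _ =
  fun eta => Q1 eta + -1 * Q2 eta); first exact: negligibleD.
by apply/funext => eta; rewrite mulN1r.
Qed.

Lemma negligible0 : negligible (fun=> 0).
Proof.
move=> c eps eps0; exists 0 => eta.
by rewrite mulr0 mul0r addr0 mulr_ge0 ?normsq_ge0 // ltW.
Qed.

Lemma negligible_sum (I : Type) (r : seq I) (P : pred I) (Q : I -> E -> C) :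
  (forall i, P i -> negligible (Q i)) ->
  negligible (fun eta => \sum_(i <- r | P i) Q i eta).
Proof.
move=> nQ; elim: r => [|i r IH].
  by under [X in negligible X]eq_fun do rewrite big_nil; exact: negligible0.
case Pi: (P i); under [X in negligible X]eq_fun do rewrite big_cons Pi; last by [].
by apply: negligibleD => //; apply: nQ.
Qed.

Lemma negligibleJ Q : negligible Q -> negligible (fun eta => conjc (Q eta)).
Proof.
move=> nQ c eps eps0; have [K h] := nQ (conjc c) _ eps0; exists K => eta.
by rewrite (le_trans _ (h eta)) // !ReImE mulNr mulrN opprK.
Qed.

Lemma negligible_of_neg Q :
  (forall (c : C) (eps : R), 0 < eps -> exists2 M : R, 0 <= M & forall eta,
     Re (c * Q eta) <= eps * normsq eta + M * normsq (cutoff (@neg_first n) eta)) ->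
  negligible Q.
Proof.
move=> nQ c eps eps0; have e2 : 0 < eps / 2 by rewrite divr_gt0.
have [M M0 hM] := nQ c _ e2.
have M1 : 0 < M + 1 by rewrite ltr_pwDr.
(* M is already fixed when [neg_first_small] is applied; [M + 1] avoids a division by 0. *)
have e3 : 0 < eps / 2 / (M + 1) by rewrite divr_gt0.
have [K hK] := neg_first_small hn e3.
exists (M * K) => eta; apply: le_trans (hM eta) _.
have : M * normsq (cutoff (@neg_first n) eta) <=
    M * (eps / 2 / (M + 1) * normsq eta + K * normsq (eigen_defect eta)).
  by rewrite ler_wpM2l // hK.
have : M * (eps / 2 / (M + 1)) * normsq eta <= eps / 2 * normsq eta.
  rewrite ler_wpM2r ?normsq_ge0 // mulrCA ler_piMr ?(ltW e2) //.
  by rewrite ler_pdivrMr // mul1r lerDl.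
lra.
Qed.

Lemma Re_mul_dot c f g : Re (c * ell2_dot f g) = rdot (c *: f) g.
Proof. by rewrite -dotZl. Qed.

Lemma negligible_defect s : negligible (fun eta => ell2_dot (translate s (eigen_defect eta)) eta).
Proof.
move=> c eps eps0; exists (eps^-1 * normc c ^+ 2) => eta.
rewrite Re_mul_dot rdotC.
have := rdot_amgm eta (c *: translate s (eigen_defect eta)) eps0.
rewrite normsqZ normsq_translate mulrA.
have := normsq_ge0 (eigen_defect eta); have := normsq_ge0 eta.
have : 0 <= eps * normsq eta by rewrite mulr_ge0 ?normsq_ge0 // ltW.
have : 0 <= eps^-1 * normc c ^+ 2 * normsq (eigen_defect eta).
  by apply: mulr_ge0 (normsq_ge0 _); rewrite mulr_ge0 ?sqr_ge0 // invr_ge0 ltW.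
lra.
Qed.

Definition coefficient s eta : C := ell2_dot (translate s eta) eta.

Lemma coefficientJ s eta : conjc (coefficient s eta) = coefficient s^-1%g eta.
Proof. by rewrite /coefficient -dotC [RHS]dot_translate invgK. Qed.

Lemma coefficient1 eta : coefficient 1%g eta = (normsq eta)%:C.
Proof. by rewrite /coefficient translate1 dot_normsq. Qed.

(** This is the form <s z eta, eta> with z expanded. *)
Lemma negligible_mul_gen s : negligible (fun eta =>
  \sum_(l < n) coefficient (s * free_gen l)%g eta - (root_n R n)%:C * coefficient s eta).
Proof.
rewrite [X in negligible X](_ : _ = fun eta => ell2_dot (translate s (eigen_defect eta)) eta).
  exact: negligible_defect.
apply/funext => eta; rewrite /eigen_defect translateD translateN translateZ translate_sum.
rewrite dotDl dotNl dotZl dot_suml; congr (_ - _); apply: eq_bigr => l _.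
by rewrite -translateM.
Qed.

(* If [eta] has no component on words with a negative first letter, no
   cancellation occurs in [s eta], which then lives on such words only. *)
Lemma negligible_neg_pos s v a : word s = rcons v a -> ~~ negative a ->
  neg_first s -> negligible (coefficient s).
Proof.
move=> sv apos sneg; apply: negligible_of_neg => c eps eps0.
exists (eps^-1 * normc c ^+ 2) => [|eta].
  by rewrite mulr_ge0 ?sqr_ge0 // invr_ge0 ltW.
set P := cutoff _ eta; set P' := cutoff (predC (@neg_first n)) eta.
have z : ell2_dot (translate s P') P' = 0.
  apply: dot_orth => t; rewrite translateE !cutoffE /=.
  case: ifPn => [spos|_]; [right|by left].
  rewrite (_ : neg_first t = true) //.
  rewrite -[t](mulVKg s) /neg_first.
  (* The empty word has no first letter and is treated apart: then t = s, which begins negative by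
     hypothesis. *)
  have [t1|t1] := boolP (nilp (word (s^-1 * t)%g)).
    rewrite (_ : (s^-1 * t)%g = 1%g); last exact/free_group_ext/nilP.
    by rewrite mulg1; exact: sneg.
  rewrite (mul_neg_start sv apos t1).
    by move: sneg; rewrite /neg_first; case: (word s).
  by move: spos t1; rewrite /neg_first; case: (word (s^-1 * t)%g).
(* Once <s P', P'> is gone, both remaining terms contain P, the small part of [eta]. *)
rewrite /coefficient (_ : ell2_dot _ _ =
   ell2_dot (translate s P') P + ell2_dot (translate s P) eta); last first.
  rewrite [in LHS](cutoff_split (@neg_first n) eta) -/P -/P'.
  rewrite [in RHS](cutoff_split (@neg_first n) eta) -/P -/P'.
  by rewrite translateD !dotDl !dotDr z addr0 addrC.
rewrite mulrDr ReD.
have -> : Re (c * ell2_dot (translate s P') P) = rdot (translate s P') (conjc c *: P).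
  by rewrite /rdot dotZr conjcK.
rewrite Re_mul_dot (rdotC (c *: _)).
have := rdot_amgm (translate s P') (conjc c *: P) eps0.
have := rdot_amgm eta (c *: translate s P) eps0.
rewrite !normsqZ !normsq_translate.
have -> : normc (conjc c) ^+ 2 = normc c ^+ 2 by rewrite !normc_sqr ReImE ImJ sqrrN.
have : eps * normsq P' <= eps * normsq eta by rewrite ler_pM2l // normsq_cutoff_le.
lra.
Qed.

(* Modulo negligible terms, [sqrt n] times [s] is the sum of the [s u_l], one
   term of which is shorter than [s]. *)
Lemma strip_right s s' v i : word s = rcons v (i, true) -> word s' = v ->
  (forall l, l != i -> negligible (coefficient (s * free_gen l)%g)) ->
  negligible (fun eta => coefficient s eta - (root_n R n)^-1%:C * coefficient s' eta).
Proof.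
move=> sv s'v hl.
have := negligible_sum (index_enum 'I_n) hl.
move/(negligibleB (negligible_mul_gen s))/(negligibleZ (- (root_n R n)^-1%:C)).
rewrite [X in negligible X -> _](_ : _ =
   fun eta => coefficient s eta - (root_n R n)^-1%:C * coefficient s' eta) //.
apply/funext => eta; rewrite (bigD1 i) //=.
rewrite (_ : (s * free_gen i)%g = s'); last first.
  apply: free_group_ext; rewrite s'v.
  exact: (rcons_inv_cancel (a := (i, false)) sv).
have r0 : (root_n R n)%:C != 0 :> C by rewrite eq_complex /= gt_eqF ?root_n_gt0.
by rewrite rmorphV ?unitfE ?gt_eqF ?root_n_gt0 //; field.
Qed.

(** The adjoint of [strip_right]: conjugation turns s into s^-1, so right multiplication by u_l
    becomes left multiplication by u_l^-1. *)
Lemma strip_left s s' j w : word s = (j, false) :: w -> word s' = w ->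
  (forall l, l != j -> negligible (coefficient ((free_gen l)^-1 * s)%g)) ->
  negligible (fun eta => coefficient s eta - (root_n R n)^-1%:C * coefficient s' eta).
Proof.
move=> sw s'w hl.
have sv : word (s^-1)%g = rcons (word_inv w) (j, true).
  by rewrite word_invE sw /word_inv /= rev_cons.
have s'v : word (s'^-1)%g = word_inv w by rewrite word_invE s'w.
have hl' l : l != j -> negligible (coefficient (s^-1 * free_gen l)%g).
  move=> /hl /negligibleJ; congr negligible; apply/funext => eta.
  by rewrite coefficientJ invgM invgK.
move: (strip_right sv s'v hl') => /negligibleJ; congr negligible.
apply/funext => eta; rewrite conjcD conjcN conjcM !coefficientJ !invgK.
by rewrite conjc_real.
Qed.

(** If s begins negative, this is [negligible_neg_pos]. Otherwise its first letter u_j is stripped: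
    for l different from j, u_l^-1 s begins negative and still ends positive, so only the shorter
    word remains, to which induction applies. *)
Lemma negligible_has_negative s v i : word s = rcons v (i, false) ->
  has (@negative n) (word s) -> negligible (coefficient s).
Proof.
move: {2}(word s) (erefl (word s)) => w; elim: w s v => [|a w IH] s v sw sv.
  by rewrite sw.
case aneg: (negative a).
  by move=> _; apply: negligible_neg_pos sv _ _ => //; rewrite /neg_first sw.
case: a sw aneg => j [] // sw _; rewrite sw /= => wneg.
have rw : reduced_word w by have := word_reduced s; rewrite sw => /reduced_tail.
have [v' wv] : exists v', w = rcons v' (i, false).
  move: sv wneg; rewrite sw; case: v => [[_ ->]//|c v [_ ->] _]; by exists v.
have nw : negligible (coefficient (FreeGroup rw)) by exact: (IH (FreeGroup rw) v' erefl wv wneg).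
have hl l : l != j -> negligible (coefficient ((free_gen l)^-1 * s)%g).
  move=> lj; have Ew : word ((free_gen l)^-1 * s)%g = (l, true) :: word s.
    rewrite word_mulE sw /=; case: eqP => // -[jl].
    by rewrite jl eqxx in lj.
  apply: (negligible_neg_pos (v := (l, true) :: v) (a := (i, false))) => //.
    by rewrite Ew sv.
  by rewrite /neg_first Ew.
have := negligibleD (strip_left (s' := FreeGroup rw) sw erefl hl)
  (negligibleZ (root_n R n)^-1%:C nw).
by congr negligible; apply/funext => eta; rewrite subrK.
Qed.

(** The values of [phi], with a decidable support and natural powers; see [phiE]. *)
Definition limit_coefficient s : R :=
  if positive_negative (word s) then (root_n R n)^-1 ^+ size (word s) else 0.

(** |eta|^2 is written [coefficient 1%g eta] so that [coefficientJ] conjugates both terms alike. *)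
Definition asymptotic s : Prop := negligible (fun eta =>
  coefficient s eta - (limit_coefficient s)%:C * coefficient 1%g eta).

(** For l different from i, s u_l ends positive but contains the negative last letter of s, so it is
    negligible; only s u_i, of word v, survives, with the factor n^(-1/2). *)
Lemma asymptotic_neg_last s s' v i : word s = rcons v (i, true) -> word s' = v ->
  asymptotic s' -> asymptotic s.
Proof.
move=> sv s'v as'.
have hl l : l != i -> negligible (coefficient (s * free_gen l)%g).
  move=> li; have Ew := mul_gen_last sv li.
  by apply: (negligible_has_negative Ew); rewrite Ew has_rcons sv has_rcons.
have := negligibleD (strip_right sv s'v hl) (negligibleZ (root_n R n)^-1%:C as').
congr negligible; apply/funext => eta.
rewrite mulrBr addrA subrK mulrA -rmorphM; congr (_ - _%:C * _).
rewrite /limit_coefficient sv positive_negative_rcons /= s'v size_rcons exprS.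
by case: positive_negative; rewrite ?mulr0.
Qed.

Lemma asymptoticP s : asymptotic s.
Proof.
move: {2}(size _) (leqnn (size (word s))) => m; elim: m s => [|m IH] s.
  rewrite leqn0 => /nilP s0; have -> : s = 1%g by apply: free_group_ext.
  have := @negligible0; congr negligible; apply/funext => eta.
  by rewrite /limit_coefficient /= expr0 mul1r subrr.
case/lastP Es: {-1}(word s) => [|v [i b]].
  by move=> _; apply: IH; rewrite Es.
(* Stated for any t, since it is applied both to s and to s^-1. *)
have neg_case (t : G) u j : word t = rcons u (j, true) ->
    (size (word t) <= m.+1)%N -> asymptotic t.
  move=> tu; rewrite tu size_rcons ltnS => um.
  have ru : reduced_word u by have := word_reduced t; rewrite tu => /reduced_rcons.
  exact: (asymptotic_neg_last (s' := FreeGroup ru) tu erefl (IH (FreeGroup ru) um)).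
case: b Es => Es sm; first exact: neg_case Es sm.
have [sneg|spos] := boolP (has (@negative n) (word s)).
  have := negligible_has_negative Es sneg; congr negligible; apply/funext => eta.
  rewrite /limit_coefficient Es positive_negative_rcons /= (_ : has _ _ = true).
    by rewrite mul0r subr0.
  by move: sneg; rewrite Es has_rcons.
(* A purely positive word has no negative last letter to strip, but its inverse does, with the same
   length and the same real limit. *)
have sizeV : size (word (s^-1)%g) = size (word s) by rewrite word_invE size_rev size_map.
have Vneg : all (@negative n) (word (s^-1)%g).
  by rewrite -[all _ _]negbK word_invE -has_negative_inv word_invK.
have : asymptotic s^-1%g.
  case/lastP EV: {-1}(word (s^-1)%g) => [|u [j b]].
    by move: sizeV; rewrite EV Es size_rcons.
  have jb : b = true by move: Vneg; rewrite EV all_rcons => /andP[].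
  by apply: (@neg_case _ u j); rewrite ?sizeV // EV jb.
move/negligibleJ; congr negligible; apply/funext => eta.
rewrite conjcD conjcN conjcM conjc_real !coefficientJ invgK invg1.
rewrite /limit_coefficient sizeV all_negative_positive_negative //.
by rewrite positive_negative_pos.
Qed.

End Negligible.

(** * The regular representation *)

Section GroupAlgebraTheory.
Variables (R : realType) (G : groupType).
Local Notation C := R[i].
Local Notation E := (ell2 R G).
Local Notation A := (group_algebra R G).
Implicit Types (s t : G) (x y : A) (f g : E) (a : C).

Lemma group_algebraP x y : (forall s, x s = y s) -> x = y.
Proof. by move=> xy; apply/val_inj/funext. Qed.

Lemma ga_support x : exists r : seq G, uniq r /\ forall s, s \notin r -> x s = 0.
Proof.
case: x => x /= xf; have /asboolP finx := xf.
exists (fset_set [set s | x s != 0]); split => [|s]; first exact: fset_uniq.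
by rewrite in_fset_set // notin_setE /= => /negP/negPn/eqP.
Qed.

Lemma fsum_seq (V : nmodType) (F : G -> V) (r : seq G) : uniq r ->
  (forall s, s \notin r -> F s = 0) -> \sum_(s \in [set: G]) F s = \sum_(s <- r) F s.
Proof.
move=> ur Fr; rewrite [RHS]fsbig_seq //; symmetry; apply: fsbig_widen => // s [_ /= sr].
by apply: Fr; apply/negP.
Qed.

Lemma fsum_linear (V : lmodType C) (h : G -> V) a x y :
  \sum_(s \in [set: G]) (a *: x + y) s *: h s =
  a *: (\sum_(s \in [set: G]) x s *: h s) + \sum_(s \in [set: G]) y s *: h s.
Proof.
have [r1 [_ xr]] := ga_support x; have [r2 [_ yr]] := ga_support y.
(* Sums over [[set: G]] split only over finite supports, so all three are cut down to one list
   covering both elements. *)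
pose r := undup (r1 ++ r2); have ur : uniq r := undup_uniq _.
have hr s : s \notin r -> x s = 0 /\ y s = 0.
  by rewrite mem_undup mem_cat negb_or => /andP[/xr -> /yr ->].
have axy s : (a *: x + y) s = a * x s + y s by [].
rewrite [LHS](fsum_seq ur) => [|s /hr[xs ys]]; last first.
  by rewrite axy xs ys mulr0 addr0 scale0r.
rewrite [X in _ = _ *: X + _](fsum_seq ur) => [|s /hr[-> _]]; last exact: scale0r.
rewrite [X in _ = _ + X](fsum_seq ur) => [|s /hr[_ ->]]; last exact: scale0r.
rewrite scaler_sumr -big_split; apply: eq_bigr => s _.
by rewrite axy scalerDl scalerA.
Qed.

Lemma fsum_delta (V : lmodType C) (h : G -> V) s :
  \sum_(t \in [set: G]) delta R s t *: h t = h s.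
Proof.
rewrite (@fsum_seq _ _ [:: s]) // => [|t].
  by rewrite big_seq1 /= eqxx scale1r.
by rewrite inE /= => /negbTE ->; rewrite scale0r.
Qed.

Lemma ga_expand x : exists r : seq G, x = \sum_(s <- r) x s *: delta R s.
Proof.
have [r [ur xr]] := ga_support x; exists r; apply: group_algebraP => t.
have ev (r' : seq G) : (\sum_(s <- r') x s *: delta R s) t = \sum_(s <- r') x s * (t == s)%:R.
  by elim/big_ind2: _ => // u v u' v' <- <-.
rewrite ev; have [tr|/[dup]/xr-> tr] := boolP (t \in r).
  rewrite (bigD1_seq t) //= eqxx mulr1 big1 ?addr0 // => s /negbTE st.
  by rewrite eq_sym st mulr0.
by rewrite big_seq big1 // => s sr; case: eqP tr sr => [->/negbTE->|]; rewrite ?mulr0.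
Qed.

Lemma ga_ind (P : A -> Prop) : P 0 ->
  (forall a s x, P x -> P (a *: delta R s + x)) -> forall x, P x.
Proof.
move=> P0 PD x; have [r ->] := ga_expand x; elim: r => [|s r IH].
  by rewrite big_nil.
by rewrite big_cons; apply: PD.
Qed.

Lemma linear_extensionP (psi : G -> C) a x y :
  linear_extension psi (a *: x + y) =
  a * linear_extension psi x + linear_extension psi y.
Proof. exact: (@fsum_linear C^o psi). Qed.

Lemma linear_extension_delta (psi : G -> C) s : linear_extension psi (delta R s) = psi s.
Proof. exact: (@fsum_delta C^o psi). Qed.

Lemma linear_extensionZ (psi : G -> C) a x :
  linear_extension psi (a *: x) = a * linear_extension psi x.
Proof.
have z : linear_extension psi 0 = 0.
  have := linear_extensionP psi 1 0 0; rewrite scaler0 addr0 mul1r => h.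
  by apply: (addrI (linear_extension psi 0)); rewrite -h addr0.
by rewrite -[a *: x]addr0 linear_extensionP z addr0.
Qed.

Lemma linear_extensionD (psi : G -> C) x y :
  linear_extension psi (x + y) = linear_extension psi x + linear_extension psi y.
Proof. by rewrite -[x]scale1r linear_extensionP mul1r scale1r. Qed.

Lemma regular_rep_linear a x y f :
  regular_rep (a *: x + y) f = a *: regular_rep x f + regular_rep y f.
Proof. by rewrite /regular_rep fsum_linear. Qed.

Lemma regular_rep_delta s f : regular_rep (delta R s) f = translate s f.
Proof. by rewrite /regular_rep fsum_delta. Qed.

Lemma regular_rep0 f : regular_rep 0 f = 0.
Proof.
have := regular_rep_linear 1 0 0 f; rewrite scaler0 addr0 scale1r => h.
by apply: (addrI (regular_rep 0 f)); rewrite -h addr0.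
Qed.

Lemma regular_repZ a x f : regular_rep (a *: x) f = a *: regular_rep x f.
Proof. by rewrite -[a *: x]addr0 regular_rep_linear regular_rep0 addr0. Qed.

Lemma regular_repD x y f : regular_rep (x + y) f = regular_rep x f + regular_rep y f.
Proof. by rewrite -[x]scale1r regular_rep_linear !scale1r. Qed.

Lemma regular_repN x f : regular_rep (- x) f = - regular_rep x f.
Proof. by rewrite -scaleN1r regular_repZ scaleN1r. Qed.

Lemma regular_rep_lin x : linear (regular_rep x).
Proof.
move=> a f g; elim/ga_ind: x => [|b s x IH]; first by rewrite !regular_rep0 scaler0 addr0.
rewrite !regular_rep_linear !regular_rep_delta IH translateD translateZ.
by rewrite !scalerDr !scalerA mulrC addrACA.
Qed.

Lemma regular_rep_vecD x f g : regular_rep x (f + g) = regular_rep x f + regular_rep x g.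
Proof. by rewrite -[f]scale1r regular_rep_lin !scale1r. Qed.

Lemma regular_rep_vec0 x : regular_rep x 0 = 0.
Proof. by apply: (addIr (regular_rep x 0)); rewrite -regular_rep_vecD !add0r. Qed.

Lemma regular_rep_vecN x f : regular_rep x (- f) = - regular_rep x f.
Proof.
apply: (addIr (regular_rep x f)).
by rewrite -regular_rep_vecD !addNr regular_rep_vec0.
Qed.

Lemma regular_rep_vecZ a x f : regular_rep x (a *: f) = a *: regular_rep x f.
Proof. by rewrite -[a *: f]addr0 regular_rep_lin regular_rep_vec0 addr0. Qed.

Lemma regular_rep_bounded x : exists2 M, 0 <= M &
  forall f, ell2_norm (regular_rep x f) <= M * ell2_norm f.
Proof.
elim/ga_ind: x => [|a s x [M M0 IH]].
  by exists 0 => // f; rewrite regular_rep0 ell2_norm0 mul0r.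
have a0 : 0 <= normc a by case: a => u v; apply: sqrtr_ge0.
exists (normc a + M) => [|f]; first by rewrite addr_ge0.
rewrite regular_rep_linear mulrDl; apply: le_trans (ell2_normD _ _) _.
by rewrite ell2_normZ regular_rep_delta ell2_norm_translate lerD2l.
Qed.

Lemma fsumZ (V : lmodType C) (h : G -> V) a x :
  \sum_(t \in [set: G]) (a * x t) *: h t = a *: \sum_(t \in [set: G]) x t *: h t.
Proof.
have [r [ur xr]] := ga_support x.
rewrite [LHS](fsum_seq ur) => [|s /xr ->]; last by rewrite mulr0 scale0r.
rewrite [X in _ = _ *: X](fsum_seq ur) => [|s /xr ->]; last exact: scale0r.
by rewrite scaler_sumr; apply: eq_bigr => s _; rewrite scalerA.
Qed.

Lemma ga_mulE x y : ga_mul x y =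
  \sum_(s \in [set: G]) x s *: (\sum_(t \in [set: G]) y t *: delta R (s * t)%g).
Proof. by apply: eq_fsbigr => s _; rewrite fsumZ. Qed.

Lemma regular_rep_mul x y f :
  regular_rep (ga_mul x y) f = regular_rep x (regular_rep y f).
Proof.
rewrite ga_mulE; elim/ga_ind: x => [|a s x IH].
  by rewrite fsbig1 ?regular_rep0 // => s _; rewrite scale0r.
rewrite fsum_linear fsum_delta !regular_rep_linear IH regular_rep_delta.
congr (_ *: _ + _); elim/ga_ind: y {IH} => [|b t y IHy].
  by rewrite fsbig1 ?regular_rep0 => [|t _]; [apply: ell2P|rewrite scale0r].
rewrite fsum_linear fsum_delta !regular_rep_linear !regular_rep_delta IHy.
by rewrite translateD translateZ translateM.
Qed.

Lemma ga_star_linear a x y : ga_star (a *: x + y) = conjc a *: ga_star x + ga_star y.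
Proof.
have [r1 [_ xr]] := ga_support x; have [r2 [_ yr]] := ga_support y.
pose r := undup (r1 ++ r2); have ur : uniq r := undup_uniq _.
have hr s : s \notin r -> x s = 0 /\ y s = 0.
  by rewrite mem_undup mem_cat negb_or => /andP[/xr -> /yr ->].
have axy s : (a *: x + y) s = a * x s + y s by [].
rewrite /ga_star [LHS](fsum_seq ur) => [|s /hr[xs ys]]; last first.
  by rewrite axy xs ys mulr0 addr0 conjc0 scale0r.
rewrite [X in _ = _ *: X + _](fsum_seq ur) => [|s /hr[-> _]]; last by rewrite conjc0 scale0r.
rewrite [X in _ = _ + X](fsum_seq ur) => [|s /hr[_ ->]]; last by rewrite conjc0 scale0r.
rewrite scaler_sumr -big_split; apply: eq_bigr => s _.
by rewrite axy conjcD conjcM scalerDl scalerA.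
Qed.

Lemma ga_star_delta s : ga_star (delta R s) = delta R s^-1%g.
Proof.
rewrite /ga_star (@fsum_seq _ _ [:: s]) // => [|t].
  by rewrite big_seq1 /= eqxx conjc1 scale1r.
by rewrite inE /= => /negbTE ->; rewrite conjc0 scale0r.
Qed.

Lemma dot_regular_rep_star x f g :
  ell2_dot (regular_rep (ga_star x) f) g = ell2_dot f (regular_rep x g).
Proof.
elim/ga_ind: x => [|a s x IH].
  rewrite regular_rep0 (_ : ga_star 0 = 0) ?regular_rep0 ?dot0l 1?dotC ?dot0l ?conjc0 //.
  by rewrite /ga_star fsbig1 // => s _; rewrite conjc0 scale0r.
rewrite ga_star_linear ga_star_delta !regular_rep_linear !regular_rep_delta.
by rewrite dotDl dotDr IH dotZl dotZr dot_translate invgK.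
Qed.

End GroupAlgebraTheory.

(** * Square roots and positivity *)

Section SquareRoot.
Variables (R : realType) (G : groupType).
Local Notation C := R[i].
Local Notation E := (ell2 R G).
Local Notation A := (group_algebra R G).
Implicit Types (s t : G) (x y : A) (f g : E) (a : C).

Lemma opnorm_le (T : E -> E) (c : R) : 0 <= c ->
  (forall f, ell2_norm (T f) <= c * ell2_norm f) -> (opnorm T <= c%:E)%E.
Proof.
move=> c0 Tc; apply: ge_ereal_sup => _ [f f1 <-]; rewrite lee_fin.
by apply: le_trans (Tc f) _; rewrite ler_piMr.
Qed.

Lemma norm_small_eq0 f (e : nat -> R) (M : R) : e @ \oo --> (0 : R) ->
  (forall k, ell2_norm f <= e k * M) -> f = 0.
Proof.
move=> e0 fe; apply: ell2_norm_eq0.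
have : e k * M @[k --> \oo] --> (0 * M : R) by apply: cvgM e0 (cvg_cst _).
rewrite mul0r => /(ler_cvg_to (cvg_cst (ell2_norm f))); apply.
by exists 0%N => // k _; apply: fe.
Qed.

Lemma small_eq0 (r M : R) (e : nat -> R) : e @ \oo --> (0 : R) ->
  (forall k, r <= e k * M) -> r <= 0.
Proof.
move=> e0 re.
have : e k * M @[k --> \oo] --> (0 * M : R) by apply: cvgM e0 (cvg_cst _).
by rewrite mul0r => /(ler_cvg_to (cvg_cst r)); apply; exists 0%N => // k _; apply: re.
Qed.

Definition self_adjoint (T : E -> E) := is_adjoint T T.

(* Picard iteration for [s = (y + s^2) / 2], that is [(1 - s)^2 = 1 - y]. *)
Fixpoint sqrt_approx y (k : nat) : A :=
  if k is k'.+1 then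
    (2^-1 : C) *: (y + ga_mul (sqrt_approx y k') (sqrt_approx y k'))
  else 0.

Section Iteration.
Variables (y : A) (q : R).
Hypotheses (q_ge0 : 0 <= q) (q_lt1 : q < 1).
Hypothesis y_adj : self_adjoint (regular_rep y).
Hypothesis y_norm : forall f, ell2_norm (regular_rep y f) <= q * ell2_norm f.

Local Notation T k := (regular_rep (sqrt_approx y k)).

Lemma approxS k f : T k.+1 f = (2^-1)%:C *: (regular_rep y f + T k (T k f)).
Proof.
rewrite /= regular_repZ regular_repD regular_rep_mul; congr (_ *: _).
by rewrite rmorphV ?unitfE // rmorph_nat.
Qed.

Lemma norm_half f : ell2_norm ((2^-1)%:C *: f) = 2^-1 * ell2_norm f.
Proof.
by rewrite !ell2_normE normsqZr sqrtrM ?sqr_ge0 // sqrtr_sqr ger0_norm ?invr_ge0.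
Qed.

(** The ball of radius q is stable under the iteration because (q + q^2) / 2 <= q. *)
Lemma approx_norm k f : ell2_norm (T k f) <= q * ell2_norm f.
Proof.
elim: k f => [|k IH] f.
  by rewrite regular_rep0 ell2_norm0 mulr_ge0 ?ell2_norm_ge0.
rewrite approxS norm_half.
have h1 := ell2_normD (regular_rep y f) (T k (T k f)).
have h2 := y_norm f; have h3 := IH (T k f).
have h4 : q * ell2_norm (T k f) <= q * (q * ell2_norm f) by rewrite ler_wpM2l.
have h5 : q * (q * ell2_norm f) <= 1 * (q * ell2_norm f).
  by rewrite ler_wpM2r ?mulr_ge0 ?ell2_norm_ge0 // ltW.
lra.
Qed.

Lemma approx_adj k : self_adjoint (T k).
Proof.
elim: k => [|k IH] f g.
  by rewrite !regular_rep0 [RHS]dotC !dot0l conjc0.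
by rewrite !approxS dotZl dotZr conjc_real dotDl dotDr y_adj !IH.
Qed.

Lemma approx_step k f : ell2_norm (T k.+1 f - T k f) <= q ^+ k * ell2_norm f.
Proof.
elim: k f => [|k IH] f.
  rewrite expr0 mul1r /= -/(sqrt_approx y 1) (approxS 0) !regular_rep0 addr0 subr0.
  rewrite norm_half; have := y_norm f.
  have : q * ell2_norm f <= 1 * ell2_norm f by rewrite ler_wpM2r ?ell2_norm_ge0 // ltW.
  have := ell2_norm_ge0 f; lra.
rewrite [X in X - _]approxS [X in _ - X]approxS -scalerBr norm_half.
rewrite opprD addrACA subrr add0r.
(* The noncommutative identity a^2 - b^2 = a (a - b) + (a - b) b. Each half gains a factor q, and
   the 1/2 of the iteration absorbs their number. *)
have -> : T k.+1 (T k.+1 f) - T k (T k f) =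
    T k.+1 (T k.+1 f - T k f) + (T k.+1 (T k f) - T k (T k f)).
  by rewrite regular_rep_vecD regular_rep_vecN addrA subrK.
have h1 := ell2_normD (T k.+1 (T k.+1 f - T k f)) (T k.+1 (T k f) - T k (T k f)).
have h2 := approx_norm k.+1 (T k.+1 f - T k f).
have h3 : q * ell2_norm (T k.+1 f - T k f) <= q * (q ^+ k * ell2_norm f).
  by rewrite ler_wpM2l // IH.
have h4 := IH (T k f).
have h5 : q ^+ k * ell2_norm (T k f) <= q ^+ k * (q * ell2_norm f).
  by rewrite ler_wpM2l ?exprn_ge0 // approx_norm.
have h6 : q ^+ k.+1 * ell2_norm f = q * (q ^+ k * ell2_norm f) by rewrite exprS mulrA.
have h7 : q ^+ k * (q * ell2_norm f) = q * (q ^+ k * ell2_norm f) by rewrite mulrCA.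
lra.
Qed.

(** The tail from index k of the geometric series of ratio q. *)
Definition rate (k : nat) : R := geometric (1 - q)^-1 q k.

Lemma rateE k : rate k = (1 - q)^-1 * q ^+ k. Proof. by []. Qed.

Lemma rate_cvg0 : rate @ \oo --> (0 : R).
Proof. by apply: cvg_geometric; rewrite ger0_norm. Qed.

Lemma rate_ge0 k : 0 <= rate k.
Proof. by rewrite rateE mulr_ge0 ?exprn_ge0 // invr_ge0 subr_ge0 ltW. Qed.

Lemma approx_cauchy f k m : (k <= m)%N ->
  ell2_norm (T m f - T k f) <= rate k * ell2_norm f.
Proof.
move=> km; have p0 : 0 < 1 - q by rewrite subr_gt0.
(* Strengthened so that the induction telescopes: consecutive rates differ by [q ^+ i]. *)
suff : ell2_norm (T m f - T k f) <= (rate k - rate m) * ell2_norm f.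
  move/le_trans; apply; rewrite ler_wpM2r ?ell2_norm_ge0 // gerBl; exact: rate_ge0.
rewrite -(subnKC km); elim: (m - k)%N => [|j IH].
  by rewrite addn0 !subrr mul0r ell2_norm0.
rewrite addnS; set i := (k + j)%N in IH *.
rewrite (_ : T i.+1 f - T k f = (T i.+1 f - T i f) + (T i f - T k f)); last first.
  by rewrite addrA subrK.
apply: le_trans (ell2_normD _ _) _.
have := approx_step i f.
have -> : rate k - rate i.+1 = q ^+ i + (rate k - rate i).
  by rewrite !rateE exprS; field; rewrite gt_eqF.
rewrite mulrDl; lra.
Qed.

Lemma approx_limit : exists T0 : E -> E,
  forall f k, ell2_norm (T0 f - T k f) <= rate k * ell2_norm f.
Proof.
suff /choice[T0 hT] : forall f, exists g, forall k,
    ell2_norm (g - T k f) <= rate k * ell2_norm f by exists T0.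
move=> f; apply: ell2_complete => [|k m km]; last exact: approx_cauchy.
rewrite -(mul0r (ell2_norm f)); apply: cvgM; [exact: rate_cvg0|exact: cvg_cst].
Qed.

(** S is 1 - T0 with T0 the limit of the iteration, whose fixed point equation y + T0^2 = 2 T0 says
    that S^2 = 1 - y. Each property of T0 follows from that of [T k], the discrepancy being at most
    [rate k] times a constant. *)
Lemma square_root : exists S : E -> E,
  [/\ reduced_algebra S, self_adjoint S & S \o S = regular_rep (delta R 1%g - y)].
Proof.
have [T0 hT] := approx_limit.
have T0lin : linear T0.
  move=> a f g; apply/eqP; rewrite -subr_eq0; apply/eqP.
  apply: (norm_small_eq0 (e := rate)
    (M := ell2_norm (a *: f + g) + (ell2_norm (a *: f) + ell2_norm g))).
    exact: rate_cvg0.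
  move=> k; set h := a *: f + g.
  rewrite (_ : T0 h - (a *: T0 f + T0 g) =
     (T0 h - T k h) + - ((a *: (T0 f - T k f)) + (T0 g - T k g))); last first.
    rewrite /h regular_rep_lin scalerBr addrACA -opprD -[RHS]addrA; congr (_ + _).
    by rewrite opprB addrA addNr add0r.
  apply: le_trans (ell2_normD _ _) _; rewrite ell2_normN mulrDr.
  apply: lerD; first exact: hT.
  apply: le_trans (ell2_normD _ _) _; rewrite mulrDr.
  apply: lerD; last exact: hT.
  rewrite !ell2_normZ mulrCA; apply: ler_wpM2l; last exact: hT.
  by case: (a) => u v; apply: sqrtr_ge0.
have T0norm f : ell2_norm (T0 f) <= (rate 0 + q) * ell2_norm f.
  rewrite -[T0 f](subrK (T 0 f)); apply: le_trans (ell2_normD _ _) _.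
  by rewrite mulrDl; apply: lerD; [exact: hT|exact: approx_norm].
have T0D f g : T0 (f + g) = T0 f + T0 g by rewrite -[f]scale1r T0lin !scale1r.
have T00 : T0 0 = 0 by apply: (addIr (T0 0)); rewrite -T0D !add0r.
have T0Z a f : T0 (a *: f) = a *: T0 f by rewrite -[a *: f]addr0 T0lin T00 addr0.
have T0B f g : T0 (f - g) = T0 f - T0 g.
  by rewrite -scaleN1r T0D T0Z scaleN1r.
have T0r f g : rdot (T0 f) g = rdot f (T0 g).
  suff le h h' : rdot (T0 h) h' <= rdot h (T0 h').
    by apply/eqP; rewrite eq_le le rdotC (rdotC (T0 f)) le.
  rewrite -subr_le0; apply: (small_eq0 (e := rate)
    (M := ell2_norm h * ell2_norm h' + ell2_norm h * ell2_norm h')).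
    exact: rate_cvg0.
  move=> k; have <- : rdot (T0 h - T k h) h' + rdot (- h) (T0 h' - T k h') =
      rdot (T0 h) h' - rdot h (T0 h').
    have := approx_adj k h h' => e; rewrite !rdotE /rdot e; lra.
  rewrite mulrDr; apply: lerD; apply: le_trans (cauchy_schwarz _ _) _.
    by rewrite mulrA; apply: ler_wpM2r (ell2_norm_ge0 _) _ _ (hT _ _).
  by rewrite ell2_normN mulrCA; apply: ler_wpM2l (ell2_norm_ge0 _) _ _ (hT _ _).
(* Replacing f by i f turns the symmetry of real parts into that of imaginary parts. *)
have T0adj : self_adjoint T0.
  move=> f g; apply: complex_ext; first exact: T0r.
  have := T0r ((0 +i* 1 : C) *: f) g; rewrite T0Z /rdot !dotZl !ReImE /= !mul0r !mul1r !sub0r.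
  by move/oppr_inj.
have T0sq f : regular_rep y f + T0 (T0 f) = T0 f + T0 f.
  apply/eqP; rewrite -subr_eq0; apply/eqP.
  apply: (norm_small_eq0 (e := rate)
    (M := (rate 0 + q) * ell2_norm f + q * ell2_norm f + (ell2_norm f + ell2_norm f))).
    exact: rate_cvg0.
  move=> k.
  have e : T k.+1 f + T k.+1 f = regular_rep y f + T k (T k f).
    by rewrite approxS -scalerDl -rmorphD (_ : 2^-1 + 2^-1 = 1) ?scale1r //; lra.
  (* By [e], the recursion cancels the terms in y and [T k], leaving only differences of T0 and an
     approximant. *)
  have -> : regular_rep y f + T0 (T0 f) - (T0 f + T0 f) =
     (T0 (T0 f - T k f) + (T0 (T k f) - T k (T k f))) -
     ((T0 f - T k.+1 f) + (T0 f - T k.+1 f)).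
    rewrite T0B addrA subrK [in RHS]addrACA -opprD e [in RHS]opprB.
    by rewrite [RHS]addrA [in RHS]addrA [in RHS](addrC _ (regular_rep y f)) ?addrA ?subrK.
  have rS : rate k.+1 <= rate k.
    rewrite !rateE exprS; apply: ler_wpM2l; first by rewrite invr_ge0 subr_ge0 ltW.
    by rewrite ler_piMl ?exprn_ge0 // ltW.
  apply: le_trans (ell2_normD _ _) _; rewrite ell2_normN mulrDr; apply: lerD.
    apply: le_trans (ell2_normD _ _) _; rewrite mulrDr; apply: lerD.
      apply: le_trans (T0norm _) _; rewrite mulrCA.
      by apply: ler_wpM2l (hT _ _); apply: addr_ge0 (rate_ge0 _) q_ge0.
    apply: le_trans (hT _ _) _.
    exact: ler_wpM2l (rate_ge0 _) _ _ (approx_norm _ _).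
  apply: le_trans (ell2_normD _ _) _; rewrite mulrDr.
  by apply: lerD; apply: le_trans (hT _ _) _; apply: ler_wpM2r (ell2_norm_ge0 _) _ _ rS.
exists (fun f => f - T0 f); split.
- split.
    split.
      by move=> a f g; rewrite T0lin scalerBr opprD addrACA.
    apply: le_lt_trans (opnorm_le (c := 1 + (rate 0 + q)) _ _) (ltry _).
      by rewrite !addr_ge0 ?rate_ge0.
    move=> f; apply: le_trans (ell2_normD _ _) _.
    by rewrite ell2_normN mulrDl mul1r lerD2l.
  move=> e e0.
  have [k _ hk] : \forall k \near \oo, `|rate k| < e.
    by move/cvgr0_norm_lt: rate_cvg0; apply.
  exists (delta R 1%g - sqrt_approx y k).
  apply: (@le_lt_trans _ _ (rate k)%:E); last first.
    by rewrite lte_fin; apply: le_lt_trans (ler_norm _) (hk k (leqnn k)).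
  apply: opnorm_le (rate_ge0 k) _ => f.
  rewrite (_ : _ f = - (T0 f - T k f)); first by rewrite ell2_normN; exact: hT.
  rewrite -[LHS]/(f - T0 f - regular_rep (delta R 1%g - sqrt_approx y k) f).
  rewrite regular_repD regular_repN regular_rep_delta translate1 opprD addrACA subrr add0r.
  by rewrite opprK opprB addrC.
- move=> f g; rewrite dotDl dotDr dotNl dotNr; congr (_ - _); exact: T0adj.
apply/funext => f; rewrite -[LHS]/((f - T0 f) - T0 (f - T0 f)).
rewrite regular_repD regular_repN regular_rep_delta translate1 T0B.
have -> : regular_rep y f = T0 f + T0 f - T0 (T0 f) by rewrite -T0sq addrK.
by rewrite !opprB -addrA; congr (_ + _); rewrite addrCA -opprD.
Qed.

End Iteration.

(** |f - t z f|^2 <= (1 - 2 t d + t^2 M^2) |f|^2, and t = d / M^2 minimises the factor. *)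
Lemma contraction_of_form z (d M : R) : 0 < d -> d < M ->
  (forall f, ell2_norm (regular_rep z f) <= M * ell2_norm f) ->
  (forall f, d * normsq f <= rdot (regular_rep z f) f) ->
  forall f, ell2_norm (regular_rep (delta R 1%g - (d / M ^+ 2)%:C *: z) f)
    <= Num.sqrt (1 - d ^+ 2 / M ^+ 2) * ell2_norm f.
Proof.
move=> d0 dM zM zd f; have M0 : 0 < M by exact: lt_trans d0 dM.
have q0 : 0 <= 1 - d ^+ 2 / M ^+ 2.
  rewrite subr_ge0 ler_pdivrMr ?exprn_gt0 // mul1r ler_sqr ?nnegrE; exact: ltW.
rewrite ell2_norm_le ?mulr_ge0 ?sqrtr_ge0 ?ell2_norm_ge0 //.
rewrite exprMn sqr_sqrtr // sqr_ell2_norm.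
rewrite regular_repD regular_repN regular_repZ regular_rep_delta translate1.
rewrite normsqB normsqZr rdotZr rdotC.
have h1 := zd f; have h2 : normsq (regular_rep z f) <= M ^+ 2 * normsq f.
  by rewrite -(sqr_ell2_norm f) -exprMn -ell2_norm_le ?mulr_ge0 ?ell2_norm_ge0 // ltW.
have t0 : 0 < d / M ^+ 2 by rewrite divr_gt0 ?exprn_gt0.
have h3 : d / M ^+ 2 * (d * normsq f) <= d / M ^+ 2 * rdot (regular_rep z f) f.
  by rewrite ler_pM2l.
have h4 : (d / M ^+ 2) ^+ 2 * normsq (regular_rep z f)
          <= (d / M ^+ 2) ^+ 2 * (M ^+ 2 * normsq f).
  by rewrite ler_pM2l ?exprn_gt0.
have e1 : (d / M ^+ 2) ^+ 2 * (M ^+ 2 * normsq f) = d / M ^+ 2 * (d * normsq f).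
  by field; rewrite gt_eqF.
have e2 : (1 - d ^+ 2 / M ^+ 2) * normsq f = normsq f - d / M ^+ 2 * (d * normsq f).
  by field; rewrite gt_eqF.
rewrite e2; lra.
Qed.

(* For [d > 0] and small [t > 0], [1 - t (y + d)] is a strict contraction, so
   [t (y + d)] is a square. *)
Lemma nonneg_of_form (psi : G -> C) tau y : positive_functional tau ->
  (forall x, tau (regular_rep x) = linear_extension psi x) -> psi 1%g = 1 ->
  self_adjoint (regular_rep y) -> (forall f, 0 <= rdot (regular_rep y f) f) ->
  0 <= linear_extension psi y.
Proof.
move=> [_ tau_pos] tauE psi1 yadj ypos.
(* Nonnegativity in [R[i]] includes being real, so d = 1 settles the imaginary part; a negative real
   part r is excluded by d = - r / 2. *)
suff shifted d : 0 < d -> 0 <= linear_extension psi y + d%:C.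
  have im0 : Im (linear_extension psi y) = 0.
    by have := ger0_Im (shifted 1 ltr01); rewrite ReImE addr0.
  apply: complex_ge0P => //; rewrite leNgt; apply/negP => neg.
  have /shifted : 0 < - Re (linear_extension psi y) / 2 by rewrite divr_gt0 ?oppr_gt0.
  rewrite lecE => /andP[_]; rewrite ReImE; move: neg.
  rewrite [Re 0]/=; move: (Re _) => r /=; lra.
move=> d0; pose z := y + d%:C *: delta R 1%g.
have zE f : regular_rep z f = regular_rep y f + d%:C *: f.
  by rewrite regular_repD regular_repZ regular_rep_delta translate1.
have [M0 M00 hM0] := regular_rep_bounded z; pose M := M0 + d + 1.
have dM : d < M by rewrite /M; lra.
have M_gt0 : 0 < M by exact: lt_trans d0 dM.
have hM f : ell2_norm (regular_rep z f) <= M * ell2_norm f.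
  by apply: le_trans (hM0 f) _; rewrite ler_wpM2r ?ell2_norm_ge0 // /M; lra.
have zd f : d * normsq f <= rdot (regular_rep z f) f.
  by rewrite zE !rdotE lerDr.
pose t := d / M ^+ 2; have t0 : 0 < t by rewrite divr_gt0 ?exprn_gt0.
pose q := Num.sqrt (1 - d ^+ 2 / M ^+ 2).
have q1 : q < 1.
  rewrite -sqrtr1 /q ltr_sqrt // ltrBlDr ltrDl divr_gt0 ?exprn_gt0 //.
have y1adj : self_adjoint (regular_rep (delta R 1%g - t%:C *: z)).
  move=> f g; rewrite !regular_repD !regular_repN !regular_repZ !regular_rep_delta.
  rewrite !translate1 !zE !dotDl !dotDr !dotNl !dotNr !dotZl !dotZr !dotDl !dotDr.
  by rewrite yadj dotZl dotZr !conjc_real.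
(* The square of S represents 1 - (1 - t z) = t z, so [tau (S \o S)] is t psi(z), and t > 0 can be
   divided out. *)
have [S [redS adjS SS]] :=
  square_root (sqrtr_ge0 _) q1 y1adj (contraction_of_form d0 dM hM zd).
have := tau_pos S S redS redS adjS; rewrite SS tauE opprB addrC subrK.
rewrite linear_extensionZ pmulr_rge0; last by rewrite ltcR.
by rewrite linear_extensionD linear_extensionZ linear_extension_delta psi1 mulr1.
Qed.

End SquareRoot.

Lemma nonpos_of_eps (R : realType) (w : R[i]) :
  (forall eps : R, 0 < eps -> 0 <= (2 * eps)%:C - w) -> Im w = 0 /\ Re w <= 0.
Proof.
case: w => a b h; split => /=.
  by have := ger0_Im (h 1 ltr01) => /=; rewrite sub0r => /eqP; rewrite oppr_eq0 => /eqP.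
rewrite leNgt; apply/negP => pos; have e0 : 0 < a / 4 by rewrite divr_gt0.
by have := h _ e0; rewrite lecE /= => /andP[_]; lra.
Qed.

(** * Uniqueness *)

Section Uniqueness.
Variables (R : realType) (n : nat).
Hypothesis hn : (2 <= n)%N.
Local Notation G := (free_group n).
Local Notation E := (ell2 R G).
Local Notation C := R[i].
Implicit Types (f g eta : E) (s t : G) (x : group_algebra R G).

Definition defect_elt : group_algebra R G :=
  gen_sum R n - (root_n R n)%:C *: delta R 1%g.

Lemma regular_rep_defect eta : regular_rep defect_elt eta = eigen_defect eta.
Proof.
rewrite /defect_elt /gen_sum /eigen_defect regular_repD regular_repN regular_repZ.
rewrite regular_rep_delta translate1; congr (_ - _).
elim: (index_enum _) => [|i r IH]; first by rewrite !big_nil regular_rep0.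
by rewrite !big_cons regular_repD regular_rep_delta IH.
Qed.

Lemma dot_star_regular_rep (H : groupType) (x : group_algebra R H) (f g : ell2 R H) :
  ell2_dot f (regular_rep (ga_star x) g) = ell2_dot (regular_rep x f) g.
Proof. by rewrite dotC dot_regular_rep_star -dotC. Qed.

Lemma reduced_eigenstate_negligible (psi : G -> C) x : is_reduced_state psi ->
  is_eigenstate (root_n R n)%:C (gen_sum R n) psi ->
  negligible (fun eta => ell2_dot (regular_rep x eta) eta) ->
  linear_extension psi x = 0.
Proof.
move=> [[_ psi1] [tau taupos tauE]] [_ eig] nx.
set zz := ga_mul _ _ in eig.
have zzE eta : regular_rep zz eta = regular_rep (ga_star defect_elt) (eigen_defect eta).
  by rewrite /zz regular_rep_mul regular_rep_defect.
pose v c := c * linear_extension psi x + conjc c * linear_extension psi (ga_star x).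
have v_le c (eps : R) : 0 < eps -> 0 <= (2 * eps)%:C - v c.
  move=> eps0; have [K hK] := nx c eps eps0.
  (* [zz] is z^*z. The adjoint of c x is subtracted too, to make y self-adjoint; its form at f is
     then twice eps |f|^2 + K |z f|^2 - Re (c <x f, f>), nonnegative by the choice of K. On the
     other side psi kills [zz], however large K is. *)
  pose y := ((2 * eps)%:C *: delta R 1%g + (2 * K)%:C *: zz)
            - (c *: x + conjc c *: ga_star x).
  have yE f : regular_rep y f = ((2 * eps)%:C *: f
      + (2 * K)%:C *: regular_rep (ga_star defect_elt) (eigen_defect f))
      - (c *: regular_rep x f + conjc c *: regular_rep (ga_star x) f).
    by rewrite /y !(regular_repD, regular_repN, regular_repZ) zzE regular_rep_delta
      translate1.
  have yadj : self_adjoint (regular_rep y).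
    move=> f g; rewrite !yE !(dotDl, dotDr, dotNl, dotNr, dotZl, dotZr) !conjc_real.
    rewrite (dot_regular_rep_star defect_elt) (dot_regular_rep_star x).
    rewrite (dot_star_regular_rep defect_elt) (dot_star_regular_rep x).
    rewrite !regular_rep_defect conjcK.
    by congr (_ - _); rewrite addrC.
  have ypos f : 0 <= rdot (regular_rep y f) f.
    rewrite yE rdotDl rdotNl !(rdotDl, rdotZl) rdot_normsq /rdot.
    rewrite (dot_regular_rep_star defect_elt) regular_rep_defect dot_normsq !dotZl.
    rewrite (dot_regular_rep_star x) (dotC (regular_rep x f)) !ReImE [Re _%:C]/=.
    have := hK f; rewrite !ReImE; lra.
  have := nonneg_of_form taupos tauE psi1 yadj ypos.
  rewrite linear_extensionD -scaleN1r linear_extensionZ !linear_extensionD.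
  by rewrite !linear_extensionZ eig linear_extension_delta psi1 mulr1 mulr0 addr0 mulN1r.
have v0 c : v c = 0.
  have im : Im (v c) = 0 by have [] := nonpos_of_eps (v_le c).
  have re d : Re (v d) <= 0 by have [] := nonpos_of_eps (v_le d).
  apply: complex_ext => //; apply/eqP; rewrite eq_le re /=.
  have -> : v c = - v (- c) by rewrite /v conjcN !mulNr -opprD opprK.
  by rewrite ReImE oppr_ge0 re.
(* With p and p' the values of psi at x and [ga_star x], these read p + p' = 0 and i (p - p') =
   0. *)
have h1 := v0 1; have h2 := v0 (0 +i* 1).
move: h1 h2; rewrite /v conjc1 !mul1r.
case: (linear_extension psi x) => a b; case: (linear_extension psi (ga_star x)) => c d.
move=> /eqP; rewrite eq_complex /= => /andP[/eqP e1 /eqP e2].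
move=> /eqP; rewrite eq_complex /= => /andP[/eqP e3 /eqP e4].
by apply: complex_ext => /=; lra.
Qed.

Lemma reduced_eigenstate_unique (psi : G -> C) : is_reduced_state psi ->
  is_eigenstate (root_n R n)%:C (gen_sum R n) psi ->
  psi = fun s => (limit_coefficient R s)%:C.
Proof.
move=> red eig; apply/funext => s.
have psi1 : psi 1%g = 1 by case: red => -[].
pose x := delta R s - (limit_coefficient R s)%:C *: delta R 1%g.
have := @reduced_eigenstate_negligible psi x red eig.
rewrite /x linear_extensionD -scaleN1r !linear_extensionZ !linear_extension_delta.
rewrite psi1 mulr1 mulN1r => h; apply/eqP; rewrite -subr_eq0; apply/eqP/h.
have := @asymptoticP R _ hn s; congr negligible; apply/funext => eta.
by rewrite regular_repD regular_repZ regular_repZ !regular_rep_delta scaleN1r dotDl dotNl dotZl.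
Qed.

Lemma phiE s : phi R n s = (limit_coefficient R s)%:C.
Proof.
rewrite /phi /limit_coefficient; have n0 := n_gt0 R hn.
rewrite (_ : (s \in positive_quotients n) = positive_negative (word s)); last first.
  by apply/idP/idP; rewrite inE => /positive_quotientsE.
case: ifP => // _; congr _%:C; rewrite /word_length /root_n -powR12_sqrt ?ltW //.
by rewrite powRN mulrC powRrM powR_mulrn ?powR_ge0 // exprVn.
Qed.

End Uniqueness.

(** * Existence *)

Section ComplexLimits.
Variable R : realType.
Local Notation C := R[i].
Implicit Types (u v : nat -> C) (a l : C).

Definition complex_cvg u l : Prop :=
  (Re (u m) @[m --> \oo] --> Re l) /\ (Im (u m) @[m --> \oo] --> Im l).

Definition complex_lim u : C :=
  lim (Re (u m) @[m --> \oo]) +i* lim (Im (u m) @[m --> \oo]).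

Lemma complex_cvg_lim u l : complex_cvg u l -> complex_lim u = l.
Proof. by move=> [re im]; apply: complex_ext; apply: cvg_lim. Qed.

Lemma complex_cvgD u v l1 l2 : complex_cvg u l1 -> complex_cvg v l2 ->
  complex_cvg (fun m => u m + v m) (l1 + l2).
Proof.
move=> [re1 im1] [re2 im2]; split; rewrite ReImE;
  under eq_cvg do rewrite ReImE; exact: cvgD.
Qed.

Lemma complex_cvgZ a u l : complex_cvg u l -> complex_cvg (fun m => a * u m) (a * l).
Proof.
move=> [re im]; split; rewrite ReImE; under eq_cvg do rewrite ReImE.
  by apply: cvgB; apply: cvgM => //; apply: cvg_cst.
by apply: cvgD; apply: cvgM => //; apply: cvg_cst.
Qed.

Lemma complex_cvg_cst l : complex_cvg (fun=> l) l.
Proof. by split; apply: cvg_cst. Qed.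

Lemma complex_cvg_sum (I : Type) (r : seq I) (F : I -> nat -> C) (l : I -> C) :
  (forall i, complex_cvg (F i) (l i)) ->
  complex_cvg (fun m => \sum_(i <- r) F i m) (\sum_(i <- r) l i).
Proof.
move=> Fl; elim: r => [|i r IH].
  rewrite big_nil (_ : (fun m => _) = fun=> 0); first exact: complex_cvg_cst.
  by apply/funext => m; rewrite big_nil.
rewrite big_cons (_ : (fun m => _) = fun m => F i m + \sum_(j <- r) F j m).
  exact: complex_cvgD.
by apply/funext => m; rewrite big_cons.
Qed.

Lemma complex_cvg_ge0 u l : (forall m, 0 <= u m) -> complex_cvg u l -> 0 <= l.
Proof.
move=> u0 [re im]; apply: complex_ge0P.
  rewrite -(cvg_lim (@Rhausdorff R) im); apply: cvg_lim => //.
  by under eq_cvg do rewrite (ger0_Im (u0 _)); exact: cvg_cst.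
apply: (ler_cvg_to (cvg_cst 0) re); exists 0%N => // m _.
by have := u0 m; rewrite lecE => /andP[].
Qed.

(** A uniform limit of convergent sequences converges; this carries limits from the group algebra to
    its norm closure. *)
Lemma cvgn_approx (u : nat -> R) :
  (forall e, 0 < e -> exists2 v, cvgn v & forall m, `|u m - v m| <= e) -> cvgn u.
Proof.
move=> ue; apply/cauchy_cvgP/cauchy_exP => e e0.
have e2 : 0 < e / 2 by rewrite divr_gt0.
have [v /cvg_ex[l vl] uv] := ue _ e2.
exists l; have [N _ hN] : \forall m \near \oo, `|l - v m| < e / 2.
  by move/cvgrPdist_lt: vl; apply.
exists N => // m /= Nm; rewrite -ball_normE /=.
rewrite (_ : l - u m = (l - v m) - (u m - v m)); last by rewrite opprB addrA subrK.
by apply: le_lt_trans (ler_normB _ _) _; rewrite [e]splitr ltr_leD // hN.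
Qed.

Lemma complex_is_cvg u :
  cvgn (fun m => Re (u m)) -> cvgn (fun m => Im (u m)) -> complex_cvg u (complex_lim u).
Proof. by []. Qed.

End ComplexLimits.

(** * Approximate eigenvectors and the limit of their vector states *)

Section Existence.
Variables (R : realType) (n : nat).
Hypothesis hn : (2 <= n)%N.
Local Notation G := (free_group n).
Local Notation E := (ell2 R G).
Local Notation C := R[i].
Implicit Types (f g eta : E) (s t : G) (x : group_algebra R G).

Lemma delta_one_sqnorm : (sqnorm (fun t : G => (t == 1%g)%:R : C^o) <= 1%:E)%E.
Proof.
apply: square_summable_bounded => r ur.
rewrite (eq_bigr (fun t => (t == 1%g)%:R : R)) => [|t _]; last first.
  by rewrite normc_sqr; case: eqP; rewrite /= ?expr1n expr0n addr0.
have [r1|r1] := boolP (1%g \in r).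
  by rewrite (bigD1_seq 1%g) // eqxx big1 /= ?addr0 // => t /negbTE ->.
rewrite big_seq big1 // => t tr; case: eqP => // t1.
by move: r1; rewrite -t1 tr.
Qed.

Lemma delta_one_summable : square_summable (fun t : G => (t == 1%g)%:R : C^o).
Proof. by apply/asboolP; apply: le_lt_trans delta_one_sqnorm (ltry _). Qed.

(* [level k] is [n^(-k/2)] times the sum of the positive words of length [k]:
   on such words [creating] is [x / sqrt n]. *)
Fixpoint level (k : nat) : E :=
  if k is k'.+1 then creating (level k') else Ell2 delta_one_summable.

Lemma level_support k t : level k t != 0 -> ~~ neg_first t /\ size (word t) = k.
Proof.
elim: k t => [|k IH] t.
  rewrite -[level 0 t]/((t == 1%g)%:R : C^o).
  by case: (t =P 1%g) => [->|_]; rewrite ?eqxx.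
move=> Lt; have tpos : ~~ neg_first t by apply: contraNN Lt => /creating_neg ->.
split=> //; have : exists i, cutoff (predC (first_letter (i, true))) (level k)
    ((free_gen i)^-1 * t)%g != 0.
  apply: contrapT => /forallNP h; move/eqP: Lt; apply.
  rewrite ell2_scaleE ell2_sumE big1 ?mulr0 // => i _.
  by have /negP/negPn/eqP := h i.
case=> i; rewrite cutoffE; case: ifPn => [/= hi|]; last by rewrite eqxx.
move=> /IH[_].
have : first_letter (i, false) t by apply: contraNT hi => /gen_inv_neg_first.
rewrite word_mulE /first_letter; case: (word t) => //= a w /eqP[->].
by rewrite /= eqxx => ->.
Qed.

Lemma cancelling_level k : cancelling (level k) = 0.
Proof.
rewrite -cancelling_neg (_ : cutoff _ _ = 0).
  rewrite /cancelling big1 ?scaler0 // => i _.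
  by apply: ell2P => t; rewrite translateE cutoffE; case: ifP.
apply: ell2P => t; rewrite cutoffE; case: ifP => // tneg.
by apply/eqP; apply: contraT => /level_support[]; rewrite tneg.
Qed.

Lemma normsq_level k : normsq (level k) = 1.
Proof.
elim: k => [|k IH].
  apply/eqP; rewrite eq_le; apply/andP; split.
    by rewrite -lee_fin normsqE; exact: delta_one_sqnorm.
  apply: le_trans (normsq_coord (level 0) 1%g).
  by rewrite normc_sqr /= expr1n expr0n addr0.
rewrite /= (normsq_creating hn) IH (_ : cutoff _ _ = 0) ?normsq0 ?mulr0 ?subr0 //.
apply: ell2P => t; rewrite cutoffE; case: ifP => // tneg.
by apply/eqP; apply: contraT => /level_support[]; rewrite tneg.
Qed.

(** Positive words meet no cancellation, so x maps [level k] to sqrt n times [level k.+1]; sums of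
    consecutive levels then telescope under z. *)
Lemma defect_level k :
  eigen_defect (level k) = (root_n R n)%:C *: (level k.+1 - level k).
Proof.
have := cancelling_creating hn (level k).
rewrite cancelling_level add0r -/(level k.+1) => ->.
rewrite addrC addKr scalerA -rmorphM divff ?scale1r //.
by rewrite gt_eqF // root_n_gt0.
Qed.

Lemma defect_sum_level m : eigen_defect (\sum_(k < m) level k) =
  (root_n R n)%:C *: (level m - level 0).
Proof.
rewrite -regular_rep_defect; elim: m => [|m IH].
  by rewrite big_ord0 subrr scaler0 regular_rep_vec0.
rewrite big_ord_recr regular_rep_vecD IH regular_rep_defect defect_level.
by rewrite -scalerDr addrC addrA subrK.
Qed.

Lemma normsq_sum_level m : normsq (\sum_(k < m) level k) = m%:R.
Proof.
rewrite normsq_sum_orth => [|i j t ij].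
  by under eq_bigr do rewrite normsq_level; rewrite sumr_const card_ord.
have [->|/level_support[_ ti]] := eqVneq (level i t) 0; first by left.
have [->|/level_support[_ tj]] := eqVneq (level j t) 0; first by right.
by move: ij; rewrite -val_eqE /= -ti -tj eqxx.
Qed.

(** The levels are orthonormal, whence the square root; [m.+1] keeps the sum nonempty. *)
Definition almost_eigenvector (m : nat) : E :=
  (Num.sqrt m.+1%:R)^-1%:C *: \sum_(k < m.+1) level k.

Lemma normsq_almost_eigenvector m : normsq (almost_eigenvector m) = 1.
Proof.
by rewrite normsqZr normsq_sum_level exprVn sqr_sqrtr // mulVf // pnatr_eq0.
Qed.

(** After telescoping only two unit vectors remain, at squared distance at most 4, while the
    normalisation divides by m + 1. *)
Lemma normsq_defect_almost_eigenvector m :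
  normsq (eigen_defect (almost_eigenvector m)) <= 4 * n%:R / m.+1%:R.
Proof.
rewrite -regular_rep_defect regular_rep_vecZ.
rewrite regular_rep_defect defect_sum_level !normsqZr root_n_sqr //.
rewrite exprVn sqr_sqrtr // mulrC ler_pM2r ?invr_gt0 ?ltr0n //.
rewrite mulrC ler_pM2r ?n_gt0 // normsqB !normsq_level.
have := rdot_amgmN (level m.+1) (level 0) (ltr01 : 0 < (1 : R)).
rewrite !normsq_level invr1; lra.
Qed.

Lemma defect_small K : K * normsq (eigen_defect (almost_eigenvector m)) @[m --> \oo]
  --> (0 : R).
Proof.
rewrite -[X in _ --> X](mulr0 K); apply: cvgM; first exact: cvg_cst.
have h0 : 4 * n%:R / m.+1%:R @[m --> \oo] --> (0 : R).
  rewrite -[X in _ --> X](mulr0 (4 * n%:R)); apply: cvgM; first exact: cvg_cst.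
  exact: cvg_harmonic.
apply: (squeeze_cvgr (f := fun=> 0) _ (cvg_cst _) h0); exists 0%N => // m _.
by rewrite normsq_ge0 normsq_defect_almost_eigenvector.
Qed.

Lemma negligible_cvg (Q : E -> C) : negligible Q ->
  complex_cvg (fun m => Q (almost_eigenvector m)) 0.
Proof.
move=> nQ; have re c : Re (c * Q (almost_eigenvector m)) @[m --> \oo] --> (0 : R).
  apply/cvgrPdist_lt => e e0; have e2 : 0 < e / 2 by rewrite divr_gt0.
  (* The factors c and - c bound the real part from above and from below. *)
  have [K1 h1] := nQ c _ e2; have [K2 h2] := nQ (- c) _ e2.
  have /cvgrPdist_lt/(_ _ e2)[N1 _ s1] := defect_small K1.
  have /cvgrPdist_lt/(_ _ e2)[N2 _ s2] := defect_small K2.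
  exists (maxn N1 N2) => // m /=; rewrite geq_max => /andP[/s1 /= d1 /s2 /= d2].
  have := h1 (almost_eigenvector m); have := h2 (almost_eigenvector m).
  move: d1 d2; rewrite !sub0r !normrN !ltr_norml mulNr !ReImE normsq_almost_eigenvector.
  by move=> /andP[_ d1] /andP[_ d2] d3 d4; apply/andP; split; lra.
split.
  by have := re 1; under eq_cvg do rewrite mul1r.
have := re (0 -i* 1); under eq_cvg do rewrite ReImE /= mul0r sub0r mulNr opprK mul1r.
by [].
Qed.

Lemma coefficient_cvg s : complex_cvg (fun m => coefficient s (almost_eigenvector m))
  (limit_coefficient R s)%:C.
Proof.
have h1 := negligible_cvg (@asymptoticP R _ hn s).
have h2 := complex_cvgD h1 (complex_cvg_cst (limit_coefficient R s)%:C).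
rewrite add0r in h2; move: h2; congr complex_cvg; apply/funext => m.
by rewrite coefficient1 normsq_almost_eigenvector mulr1 subrK.
Qed.

Definition vector_state (m : nat) (T : E -> E) : C :=
  ell2_dot (T (almost_eigenvector m)) (almost_eigenvector m).

(* A junk value outside the reduced algebra, where the limit need not exist. *)
Definition limit_state (T : E -> E) : C := complex_lim (fun m => vector_state m T).

Local Notation psi0 := (fun s => (limit_coefficient R s)%:C).

Lemma vector_state_rep_cvg x : complex_cvg (fun m => vector_state m (regular_rep x))
  (linear_extension psi0 x).
Proof.
elim/ga_ind: x => [|a s x IH].
  rewrite (_ : linear_extension _ 0 = 0); last first.
    by rewrite -(scale0r (0 : group_algebra R G)) linear_extensionZ mul0r.
  rewrite (_ : (fun m => _) = fun=> 0); first exact: complex_cvg_cst.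
  by apply/funext => m; rewrite /vector_state regular_rep0 dot0l.
rewrite linear_extensionP linear_extension_delta.
rewrite (_ : (fun m => _) = fun m => a * coefficient s (almost_eigenvector m)
   + vector_state m (regular_rep x)); last first.
  apply/funext => m.
  by rewrite /vector_state regular_rep_linear regular_rep_delta dotDl dotZl.
by apply: complex_cvgD IH; apply: complex_cvgZ; apply: coefficient_cvg.
Qed.

Lemma norm_almost_eigenvector m : ell2_norm (almost_eigenvector m) = 1.
Proof. by rewrite ell2_normE normsq_almost_eigenvector sqrtr1. Qed.

Lemma opnorm_ub (T : E -> E) m :
  ((ell2_norm (T (almost_eigenvector m)))%:E <= opnorm T)%E.
Proof.
apply: ereal_sup_ubound; exists (almost_eigenvector m) => //=.
by rewrite norm_almost_eigenvector.
Qed.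

Lemma vector_state_cvg T : reduced_algebra T ->
  complex_cvg (fun m => vector_state m T) (limit_state T).
Proof.
move=> [_ redT].
(* One argument for both parts of the inner product, h being either. The vectors have norm 1, so
   closeness in operator norm is closeness uniform in m. *)
have approx (h : E -> E -> R) : (forall m f, `|h f (almost_eigenvector m)| <= ell2_norm f) ->
    (forall f g eta, h (f - g) eta = h f eta - h g eta) ->
    (forall x, cvgn (fun m => h (regular_rep x (almost_eigenvector m)) (almost_eigenvector m))) ->
    cvgn (fun m => h (T (almost_eigenvector m)) (almost_eigenvector m)).
  move=> hle hB hx; apply: cvgn_approx => e e0; have [x Tx] := redT e e0.
  exists (fun m => h (regular_rep x (almost_eigenvector m)) (almost_eigenvector m)) => // m.
  rewrite -hB; apply: le_trans (hle _ _) _; rewrite -lee_fin.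
  exact: le_trans (opnorm_ub (T - regular_rep x)%R m) (ltW Tx).
have bound f m : `|rdot f (almost_eigenvector m)| <= ell2_norm f.
  rewrite ler_norml; have := cauchy_schwarz f (almost_eigenvector m).
  have := cauchy_schwarz (- f) (almost_eigenvector m).
  rewrite rdotNl ell2_normN norm_almost_eigenvector mulr1 => h1 h2.
  by apply/andP; split=> //; rewrite lerNl.
have ImRe (z : C) : Im z = Re ((0 -i* 1) * z).
  by rewrite ReImE /= mul0r sub0r mulNr opprK mul1r.
have cvRe : cvgn (fun m => rdot (T (almost_eigenvector m)) (almost_eigenvector m)).
  apply: approx => [m f|f g eta|x]; first exact: bound.
    by rewrite rdotDl rdotNl.
  by have [re _] := vector_state_rep_cvg x; apply/cvg_ex; eexists; exact: re.
have cvIm : cvgn (fun m => Im (ell2_dot (T (almost_eigenvector m)) (almost_eigenvector m))).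
  apply: (approx (fun f g => Im (ell2_dot f g))) => [m f|f g eta|x].
  - rewrite ImRe -dotZl; apply: le_trans (bound _ _) _.
    by rewrite ell2_normZ /= expr0n sqrrN expr1n add0r sqrtr1 mul1r.
  - by rewrite dotDl dotNl !ReImE.
  by have [_ im] := vector_state_rep_cvg x; apply/cvg_ex; eexists; exact: im.
exact: complex_is_cvg cvRe cvIm.
Qed.

Lemma limit_stateE T l : complex_cvg (fun m => vector_state m T) l -> limit_state T = l.
Proof. exact: complex_cvg_lim. Qed.

(* Closure of the reduced algebra under products is bypassed: these values are
   the [|T xi|^2], which are uniformly close to the [|x xi|^2]. *)
Lemma vector_state_square_cvg S T : reduced_algebra T -> is_adjoint T S ->
  complex_cvg (fun m => vector_state m (S \o T)) (limit_state (S \o T)).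
Proof.
move=> [[_ bT] redT] adj.
have E1 m : vector_state m (S \o T) = (normsq (T (almost_eigenvector m)))%:C.
  by rewrite /vector_state /= dotC -adj dot_normsq conjc_real.
apply: complex_is_cvg; last first.
  by apply/cvg_ex; exists 0; under eq_cvg do rewrite E1; exact: cvg_cst.
rewrite (_ : (fun m => _) = fun m => normsq (T (almost_eigenvector m))); last first.
  by apply/funext => m; rewrite E1.
have [M M0 hM] : exists2 M : R, 0 <= M & forall m, ell2_norm (T (almost_eigenvector m)) <= M.
  have T0 := le_trans (_ : (0%:E <= _)%E) (opnorm_ub T 0).
  have {}T0 : (0 <= opnorm T)%E by apply: T0; rewrite lee_fin ell2_norm_ge0.
  have fT : opnorm T \is a fin_num by rewrite ge0_fin_numE.
  exists (fine (opnorm T)) => [|m]; first exact: fine_ge0.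
  by rewrite -lee_fin fineK //; exact: opnorm_ub.
apply: cvgn_approx => e e0.
(* For norms a <= M and b within d of a, |a^2 - b^2| <= d (2 M + d) <= d (2 M + 1) <= e, using d <=
   1. *)
pose d := Num.min 1 (e / (2 * M + 1)).
have M1 : 0 < 2 * M + 1 by rewrite ltr_wpDl ?mulr_ge0.
have d0 : 0 < d by rewrite lt_min ltr01 divr_gt0.
have d1 : d <= 1 by rewrite ge_min lexx.
have dM : d * (2 * M + 1) <= e by rewrite -ler_pdivlMr // ge_min lexx orbT.
have [x Tx] := redT d d0.
exists (fun m => normsq (regular_rep x (almost_eigenvector m))) => [|m].
  have [re _] := vector_state_rep_cvg (ga_mul (ga_star x) x).
  apply/cvg_ex; eexists; move: re; under eq_cvg do
    rewrite /vector_state regular_rep_mul dot_regular_rep_star dot_normsq.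
  exact.
set xi := almost_eigenvector m.
have close : ell2_norm (T xi - regular_rep x xi) <= d.
  rewrite -lee_fin; exact: le_trans (opnorm_ub (T - regular_rep x)%R m) (ltW Tx).
have h1 : ell2_norm (T xi) <= ell2_norm (regular_rep x xi) + d.
  rewrite -[T xi](subrK (regular_rep x xi)) addrC.
  by apply: le_trans (ell2_normD _ _) _; rewrite lerD2l.
have h2 : ell2_norm (regular_rep x xi) <= ell2_norm (T xi) + d.
  rewrite -[regular_rep x xi](subrK (T xi)) addrC.
  apply: le_trans (ell2_normD _ _) _; rewrite lerD2l -ell2_normN opprB //.
rewrite -!sqr_ell2_norm; have := hM m; rewrite -/xi.
have := ell2_norm_ge0 (T xi); have := ell2_norm_ge0 (regular_rep x xi).
move: h1 h2; move: (ell2_norm _) (ell2_norm _) => a b h1 h2 a0 b0 bM.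
rewrite ler_norml; apply/andP; split; nra.
Qed.

Lemma limit_state_positive : positive_functional limit_state.
Proof.
split=> [a S T redS redT|S T redS redT adj].
  (* Convergence along [a *: S + T] is inherited from S and T directly, rather than from its
     membership in the reduced algebra. *)
  apply: limit_stateE.
  have := complex_cvgD (complex_cvgZ a (vector_state_cvg redS)) (vector_state_cvg redT).
  congr complex_cvg; apply/funext => m.
  by rewrite /vector_state -dotZl -dotDl.
apply: complex_cvg_ge0 (vector_state_square_cvg redT adj) => m.
by rewrite /vector_state /= dotC -adj dot_normsq conjc_real lecR normsq_ge0.
Qed.

(** The double sum is a limit of the numbers |sum_j c_j g_j xi|^2, with xi the almost
    eigenvectors. *)
Lemma limit_coefficient_state : is_state (psi0 : G -> C).
Proof.
split=> [k g c|]; last by rewrite /limit_coefficient /= expr0.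
have cv : complex_cvg (fun m => \sum_(i < k) \sum_(j < k) conjc (c i) * c j *
      coefficient ((g i)^-1 * g j)%g (almost_eigenvector m))
    (\sum_(i < k) \sum_(j < k) conjc (c i) * c j * psi0 ((g i)^-1 * g j)%g).
  apply: complex_cvg_sum => i; apply: complex_cvg_sum => j.
  exact: complex_cvgZ (coefficient_cvg _).
apply: complex_cvg_ge0 cv => m; set xi := almost_eigenvector m.
have -> : \sum_(i < k) \sum_(j < k) conjc (c i) * c j * coefficient ((g i)^-1 * g j)%g xi
   = (normsq (\sum_(j < k) c j *: translate (g j) xi))%:C.
  rewrite -dot_normsq dot_sumr; apply: eq_bigr => i _; rewrite dot_suml.
  apply: eq_bigr => j _; rewrite dotZl dotZr mulrA (mulrC (c j)); congr (_ * _).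
  by rewrite /coefficient translateM dot_translate invgK.
by rewrite lecR normsq_ge0.
Qed.

Lemma limit_coefficient_reduced_eigenstate :
  is_reduced_state (psi0 : G -> C) /\ is_eigenstate (root_n R n)%:C (gen_sum R n) psi0.
Proof.
split; first split; first exact: limit_coefficient_state.
  exists limit_state; first exact: limit_state_positive.
  by move=> x; apply: limit_stateE; apply: vector_state_rep_cvg.
split; first exact: limit_coefficient_state.
(* The value at z^*z is the limit of the |z xi|^2, which tend to 0. *)
set zz := ga_mul _ _; rewrite -(complex_cvg_lim (vector_state_rep_cvg zz)).
apply: complex_cvg_lim.
rewrite (_ : (fun m => _) = fun m => (normsq (eigen_defect (almost_eigenvector m)))%:C).
  split; last exact: cvg_cst.
  by have := defect_small 1; under eq_cvg do rewrite mul1r.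
apply/funext => m; rewrite /vector_state /zz regular_rep_mul.
by rewrite dot_regular_rep_star regular_rep_defect dot_normsq.
Qed.

End Existence.

Theorem theorem4p3 (R : realType) (n : nat) (hn : (2 <= n)%N)
    (psi : free_group n -> R[i]) :
  is_reduced_state psi /\
    is_eigenstate (Num.sqrt (n%:R : R))%:C (gen_sum R n) psi
  <-> psi = phi R n.
Proof.
have -> : phi R n = fun s => (limit_coefficient R s)%:C.
  by apply/funext => s; apply: phiE.
split=> [[red eig]|->]; first exact: reduced_eigenstate_unique.
exact: limit_coefficient_reduced_eigenstate.
Qed.
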